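(* Suppose that $F:\mathcal K\to L^2(\Omega)$ is uniformly continuous. Let $N\in\mathbb N$, let $\bar m_1,\dots,\bar m_N>0$ with $\sum_i\bar m_i=1$, let $\bar x_1\le\bar x_2\le\dots\le\bar x_N$ be real numbers and let $\bar v_1,\dots,\bar v_N\in\mathbb R$. With $w_0=0$, $w_i=\sum_{j\le i}\bar m_j$, $W_i=[w_{i-1},w_i)$, set $\bar X=\sum_{i=1}^N\bar x_i\mathbf 1_{W_i}$ and $\bar V=\sum_{i=1}^N\bar v_i\mathbf 1_{W_i}$. Let $(X,V)$ be the curve obtained from $(\bar X,\bar V)$ by the discrete sticky evolution. Then: (1) $(X,V)$ is a generalized Lagrangian solution with initial data $(\bar X,\bar V)$. (2) If $F$ is sticking, then $(X,V)$ is a sticky Lagrangian solution (with initial data $(\bar X,\bar V)$).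
   Context: $\Omega=(0,1)$. $\mathcal K\subset L^2(\Omega)$ is the closed convex cone of nondecreasing functions (right-continuous representatives). For $X\in\mathcal K$: $\Omega_X$ is the set of $m\in\Omega$ such that $X$ is constant in a neighborhood of $m$; $\mathcal H_X:=\{U\in L^2(\Omega):U\text{ is (a.e.) constant in each interval }(\alpha,\beta)\subset\Omega_X\}$, with orthogonal complement $\mathcal H_X^\perp$; $\partial I_{\mathcal K}(X)=\{W\in L^2(\Omega):\int_\Omega W(\tilde X-X)\,dm\le0\ \forall\tilde X\in\mathcal K\}$. $\mathsf P_C$ denotes the metric projection in $L^2(\Omega)$ onto a closed convex set $C$. For $Y,X\in L^1(\Omega)$, $Y\prec X$ means $\int_\Omega\psi(Y)\,dm\le\int_\Omega\psi(X)\,dm$ for all convex lower semicontinuous $\psi:\mathbb R\to[0,\infty]$. Discrete sticky evolution from $(\bar X,\bar V)$: a pair $(X,V):[0,\infty)\to\mathcal K\times L^2(\Omega)$, with $X$ continuous in time and $X(0)=\bar X$, obtained as follows. Particles (indices) with the same initial position are first merged into one particle carrying their total mass and total momentum, i.e. $V(0)=\mathsf P_{\mathcal H_{\bar X}}(\bar V)$ (so $V(0)=\bar V$ if the $\bar x_i$ are pairwise distinct). There are finitely many collision times $0=t_0<t_1<\dots<t_{K-1}<t_K=\infty$. On each $[t_{k-1},t_k)$ one has $\mathcal H_{X(t)}=\mathcal H_{X(t_{k-1})}$ (i.e. $X(t)$ is piecewise constant on a fixed finite partition of $\Omega$ into intervals, with pairwise distinct values), and $X,V$ solve the finite-dimensional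 ODE system $\dot X(t)=V(t)$, $\dot V(t)=\mathsf P_{\mathcal H_{X(t)}}(F[X(t)])$; if $k<K$, then $t_k$ is the first time after $t_{k-1}$ at which two values of $X(t)$ on different intervals of that partition coincide. At each collision time $t_k$, $1\le k<K$, $X$ is continuous, $\mathcal H_{X(t_k)}$ is strictly contained in $\mathcal H_{X(t)}$ for $t<t_k$ (colliding particles are merged), and $V(t_k)=\mathsf P_{\mathcal H_{X(t_k)}}(V(t_k-))$. $F$ is uniformly continuous if there is $C\ge0$ with $\|F[X]\|_{L^2(\Omega)}\le C(1+\|X\|_{L^2(\Omega)})$ for all $X\in\mathcal K$ and a modulus of continuity $\omega$ (concave continuous $\omega:[0,\infty)\to[0,\infty)$ with $0=\omega(0)<\omega(r)$ for $r>0$) with $\|F[X_1]-F[X_2]\|_{L^2(\Omega)}\le\omega(\|X_1-X_2\|_{L^2(\Omega)})$ for all $X_1,X_2\in\mathcal K$. $F$ is sticking if for all $X,Y\in\mathcal K$ with $Y\in\mathcal H_X$ one has $F[X]-\mathsf P_{\mathcal H_X}(F[X])\in\partial I_{\mathcal K}(Y)$. A Lagrangian solution with initial data $(\bar X,\bar V)$ is a curve $X\in\mathrm{Lip}_{\rm loc}([0,\infty);\mathcal K)$ with $X(0)=\bar X$ and $\dot X(t)+\partial I_{\mathcal K}(X(t))\ni\bar V+\int_0^tF[X(s)]\,ds$ for a.e. $t>0$; it is sticky if $\Omega_{X(t_1)}\subset\Omega_{X(t_2)}$ whenever $t_1\le t_2$. A generalized Lagrangian solution with initial data $(\bar X,\bar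 V)$ is a curve $X\in\mathrm{Lip}_{\rm loc}([0,\infty);\mathcal K)$ with $X(0)=\bar X$ for which there is $Z\in L^\infty_{\rm loc}([0,\infty);L^2(\Omega))$ with $Z(t)-F[X(t)]\in\mathcal H_{X(t)}^\perp$ and $Z(t)\prec F[X(t)]$ for a.e. $t>0$, such that: (i) $\dot X(t)+\partial I_{\mathcal K}(X(t))\ni\bar V+\int_0^tZ(s)\,ds$ for a.e. $t>0$; (ii) the right derivative $V=\frac{d^+}{dt}X$ satisfies $V(t)+\partial I_{\mathcal K}(X(t))\ni V(t_1)+\int_{t_1}^tZ(s)\,ds$ for all $t\ge t_1\ge0$; (iii) $X(t_2)=\mathsf P_{\mathcal K}\big(X(t_1)+(t_2-t_1)V(t_1)+\int_{t_1}^{t_2}(t_2-s)Z(s)\,ds\big)$ for all $t_2\ge t_1\ge0$. Saying that the pair $(X,V)$ is such a solution means that $X$ is one and $V$ is its right derivative.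
   Formalization: For initial data (X̄,V̄), claims (1),(2) are proved if V̄−V(0)∈∂I_K(X̄), a necessary condition, automatic for distinct x̄_i (fails e.g. if coincident particles move apart); with merged velocity V(0)=P_{H_X̄}(V̄) in place of V̄ they are proved always. *)

(* Defs.v *)
From HB Require Import structures.
From mathcomp Require Import all_boot all_order all_algebra.
From mathcomp Require Import all_classical all_reals all_analysis.
From mathcomp Require Import measurable_realfun.

Set Implicit Arguments.
Unset Strict Implicit.
Unset Printing Implicit Defensive.
Import Order.TTheory GRing.Theory Num.Theory.
Import numFieldNormedType.Exports.
Local Open Scope classical_set_scope.
Local Open Scope ring_scope.

Definition Omega (R : realType) : set R := `]0, 1[%classic.
Arguments Omega : clear implicits.

Definition leb_Omega (R : realType) :=
  mrestr (@lebesgue_measure R) (measurable_itv `]0%R, 1%R[).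
Arguments leb_Omega : clear implicits.
HB.instance Definition _ (R : realType) := Measure.on (leb_Omega R).

(* Elements of [L2 R] are square-integrable functions, not classes: equality in
   the Hilbert space L^2(Omega) is [L2norm (f - g) = 0] (see [L2eq]), never [=].
   Only the values on Omega matter. *)
Definition L2 (R : realType) := LfunType (leb_Omega R) (lee1n 2).
HB.instance Definition _ (R : realType) := GRing.Lmodule.on (L2 R).

Definition L2norm (R : realType) (f : L2 R) : R :=
  fine ('N[leb_Omega R]_2[EFin \o f])%E.

Definition inner (R : realType) (f g : L2 R) : R :=
  \int[leb_Omega R]_x (f x * g x).

Definition L2eq (R : realType) (f g : L2 R) : Prop := L2norm (f - g) = 0.

Definition L2cvg (R : realType) (I : Type) (u : I -> L2 R) (Fi : set_system I)
    (l : L2 R) : Prop :=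
  L2norm (u i - l) @[i --> Fi] --> (0 : R).

(* [P] is the metric projection of [Y] onto [C] (unique up to [L2eq] when [C] is
   closed and convex). *)
Definition is_proj (R : realType) (C : set (L2 R)) (Y P : L2 R) : Prop :=
  C P /\ forall Q, C Q -> L2norm (Y - P) <= L2norm (Y - Q).

Definition orthogonal_compl (R : realType) (S : set (L2 R)) : set (L2 R) :=
  [set W | forall U, S U -> inner W U = 0].

(* Each class is represented by its right-continuous representative, which is
   what makes the pointwise definition of [Omega_of] meaningful. *)
Definition Kcone (R : realType) : set (L2 R) :=
  [set X | (forall m1 m2 : R, Omega R m1 -> Omega R m2 -> m1 <= m2 ->
              X m1 <= X m2) /\
           (forall m : R, Omega R m -> X m' @[m' --> m^'+] --> (X m : R))].
Arguments Kcone : clear implicits.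

Definition Omega_of (R : realType) (X : L2 R) : set R :=
  [set m | Omega R m /\ \forall m' \near m, X m' = X m].

Definition H_of (R : realType) (X : L2 R) : set (L2 R) :=
  [set U | forall a b : R, `]a, b[%classic `<=` Omega_of X ->
     exists c : R, {ae leb_Omega R, forall m, `]a, b[%classic m -> U m = c}].

Definition subdiffK (R : realType) (X : L2 R) : set (L2 R) :=
  [set W | forall X', Kcone R X' -> inner W (X' - X) <= 0].

Definition convex_ereal (R : realType) (psi : R -> \bar R) : Prop :=
  forall (x y t : R), 0 <= t <= 1 ->
    (psi (t * x + (1 - t) * y)%R <= t%:E * psi x + (1 - t)%:E * psi y)%E.

Definition convex_dominated (R : realType) (Y X : L2 R) : Prop :=
  forall psi : R -> \bar R, (forall x, 0 <= psi x)%E -> convex_ereal psi ->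
    lower_semicontinuous psi ->
    (\int[leb_Omega R]_m psi (Y m) <= \int[leb_Omega R]_m psi (X m))%E.

(* [F : L2 R -> L2 R] stands for a map K -> L^2:
   its values outside [Kcone R] are never used. *)

Definition is_modulus (R : realType) (omega : R -> R) : Prop :=
  [/\ omega 0 = 0,
      forall r, 0 < r -> 0 < omega r,
      {within `[0, +oo[, continuous omega} &
      forall x y t : R, 0 <= x -> 0 <= y -> 0 <= t <= 1 ->
        t * omega x + (1 - t) * omega y <= omega (t * x + (1 - t) * y)].

Definition force_unif_continuous (R : realType) (F : L2 R -> L2 R) : Prop :=
  (exists2 C : R, 0 <= C &
     forall X, Kcone R X -> L2norm (F X) <= C * (1 + L2norm X)) /\
  (exists2 omega : R -> R, is_modulus omega &
     forall X1 X2, Kcone R X1 -> Kcone R X2 ->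
       L2norm (F X1 - F X2) <= omega (L2norm (X1 - X2))).

Definition force_sticking (R : realType) (F : L2 R -> L2 R) : Prop :=
  forall X Y P, Kcone R X -> Kcone R Y -> H_of X Y ->
    is_proj (H_of X) (F X) P -> subdiffK Y (F X - P).

Definition deriv_within (R : realType) (S : set R) (X : R -> L2 R) (t : R)
    (D : L2 R) : Prop :=
  L2cvg (fun s => (s - t)^-1 *: (X s - X t)) (within S (dnbhs t)) D.

Definition time_deriv (R : realType) (X : R -> L2 R) := deriv_within setT X.

Definition right_deriv (R : realType) (X : R -> L2 R) (t : R) :=
  deriv_within `]t, +oo[%classic X t.

Definition L2_continuous (R : realType) (X : R -> L2 R) : Prop :=
  forall t : R, 0 <= t -> L2cvg X (within `[0, +oo[%classic (nbhs t)) (X t).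

Definition lip_loc (R : realType) (X : R -> L2 R) : Prop :=
  forall T : R, 0 <= T -> exists C : R, forall s t, 0 <= s <= T -> 0 <= t <= T ->
    L2norm (X s - X t) <= C * `|s - t|.

Record tsimple (R : realType) := TSimple {
  ts_size : nat;
  ts_set : 'I_ts_size -> set (measurableTypeR R);
  ts_val : 'I_ts_size -> L2 R;
  ts_measurable : forall i, measurable (ts_set i) }.

Definition ts_fun (R : realType) (S : tsimple R) (t : R) : L2 R :=
  \sum_(i < ts_size S) (\1_(ts_set i) t : R) *: ts_val i.

Definition ts_integral (R : realType) (a b : R) (S : tsimple R) : L2 R :=
  \sum_(i < ts_size S)
    fine (lebesgue_measure (ts_set i `&` `[a, b]%classic)) *: ts_val i.

Definition ts_approx (R : realType) (a b : R) (Z : R -> L2 R)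
    (S : nat -> tsimple R) : Prop :=
  {ae @lebesgue_measure R, forall t, `[a, b]%classic t ->
     L2cvg (fun n => ts_fun (S n) t) \oo (Z t)}.

Definition strongly_measurable (R : realType) (a b : R) (Z : R -> L2 R) : Prop :=
  exists S : nat -> tsimple R, ts_approx a b Z S.

(* A value [I] of the Bochner integral, unique up to [L2eq]; [ts_approx] is the
   strong measurability of [Z] (almost everywhere limit of simple functions). *)
Definition bochner_integral (R : realType) (a b : R) (Z : R -> L2 R)
    (I : L2 R) : Prop :=
  exists S : nat -> tsimple R,
    [/\ ts_approx a b Z S,
        (\int[lebesgue_measure]_(t in `[a, b])
           (L2norm (Z t - ts_fun (S n) t))%:E)%E @[n --> \oo] --> 0%E &
        L2cvg (fun n => ts_integral a b (S n)) \oo I].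

Definition Linfty_loc (R : realType) (Z : R -> L2 R) : Prop :=
  forall T : R, 0 < T -> strongly_measurable 0 T Z /\
    exists M : R, {ae @lebesgue_measure R, forall t, `[0, T]%classic t ->
                      L2norm (Z t) <= M}.

Definition curve_from (R : realType) (Xbar : L2 R) (X : R -> L2 R) : Prop :=
  [/\ forall t, 0 <= t -> Kcone R (X t), lip_loc X & L2eq (X 0) Xbar].

Definition lagrangian_solution (R : realType) (F : L2 R -> L2 R)
    (Xbar Vbar : L2 R) (X : R -> L2 R) : Prop :=
  curve_from Xbar X /\
  {ae @lebesgue_measure R, forall t, 0 < t ->
     exists D I, [/\ time_deriv X t D,
                     bochner_integral 0 t (F \o X) I &
                     subdiffK (X t) (Vbar + I - D)]}.

Definition sticky (R : realType) (X : R -> L2 R) : Prop :=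
  forall t1 t2 : R, 0 <= t1 -> t1 <= t2 -> Omega_of (X t1) `<=` Omega_of (X t2).

Definition is_velocity (R : realType) (X V : R -> L2 R) : Prop :=
  forall t, 0 <= t -> right_deriv X t (V t).

Definition sticky_lagrangian_pair (R : realType) (F : L2 R -> L2 R)
    (Xbar Vbar : L2 R) (X V : R -> L2 R) : Prop :=
  [/\ lagrangian_solution F Xbar Vbar X, sticky X & is_velocity X V].

Definition generalized_lagrangian_pair (R : realType) (F : L2 R -> L2 R)
    (Xbar Vbar : L2 R) (X V : R -> L2 R) : Prop :=
  [/\ curve_from Xbar X,
      is_velocity X V &
      exists Z : R -> L2 R,
        [/\ Linfty_loc Z,
            {ae @lebesgue_measure R, forall t, 0 < t ->
               orthogonal_compl (H_of (X t)) (Z t - F (X t)) /\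
               convex_dominated (Z t) (F (X t))},
            {ae @lebesgue_measure R, forall t, 0 < t ->
               exists D I, [/\ time_deriv X t D,
                               bochner_integral 0 t Z I &
                               subdiffK (X t) (Vbar + I - D)]},
            (forall t1 t, 0 <= t1 -> t1 <= t ->
               exists2 I, bochner_integral t1 t Z I &
                          subdiffK (X t) (V t1 + I - V t)) &
            (forall t1 t2, 0 <= t1 -> t1 <= t2 ->
               exists2 I, bochner_integral t1 t2 (fun s => (t2 - s) *: Z s) I &
                          is_proj (Kcone R)
                            (X t1 + (t2 - t1) *: V t1 + I) (X t2))]].

(* [X0] and [Y] are right-continuous step functions on the same partition and
   [X0] has distinct values on distinct intervals: two of the values of [Y] on
   different intervals coincide. *)
Definition values_coincide (R : realType) (X0 Y : L2 R) : Prop :=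
  exists m1 m2 : R, [/\ Omega R m1, Omega R m2, X0 m1 <> X0 m2 & Y m1 = Y m2].

(* The collision times are tc 0 = 0 < ... < tc K = +oo; on each stage
   [tc k, tc k.+1) derivatives are taken within the stage, hence from the right
   at its left end. *)
Definition discrete_sticky_evolution (R : realType) (F : L2 R -> L2 R)
    (Xbar Vbar : L2 R) (X V : R -> L2 R) : Prop :=
  [/\ forall t, 0 <= t -> Kcone R (X t),
      L2_continuous X,
      L2eq (X 0) Xbar,
      is_proj (H_of Xbar) Vbar (V 0) &
      exists (K : nat) (tc : nat -> \bar R),
        [/\ tc 0%N = 0%E, tc K = +oo%E,
            (forall k, (k < K)%N -> (tc k < tc k.+1)%E),
            (forall k t0, (k < K)%N -> tc k = t0%:E ->
               let stage := [set t : R | (tc k <= t%:E)%E /\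
                                         (t%:E < tc k.+1)%E] in
               (forall t, stage t ->
                  [/\ H_of (X t) = H_of (X t0),
                      ~ values_coincide (X t0) (X t),
                      deriv_within stage X t (V t) &
                      exists2 P, is_proj (H_of (X t)) (F (X t)) P &
                                 deriv_within stage V t P]) /\
               (forall t1, tc k.+1 = t1%:E -> values_coincide (X t0) (X t1))) &
            (forall k tk, (0 < k < K)%N -> tc k = tk%:E ->
               (forall t, 0 <= t < tk -> H_of (X tk) `<` H_of (X t)) /\
               (exists2 Vm, L2cvg V (tk^'-) Vm &
                            is_proj (H_of (X tk)) Vm (V tk)))]].

Lemma indic_Lfun (R : realType) (A : set (measurableTypeR R)) :
  measurable A -> (\1_A : _ -> R) \in Lfun (leb_Omega R) 2%:R%:E.
Proof.
move=> mA; rewrite inE; apply/andP; split.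
  by rewrite inE /=; exact: measurable_indic.
rewrite inE /= /finite_norm unlock /Lnorm; apply: poweR_lty.
apply: (@le_lt_trans _ _ (\int[leb_Omega R]_x (cst 1%:E x))%E).
  apply: ge0_le_integral => //=.
  - apply/measurable_EFinP; apply: (measurableT_comp (measurable_powR _)) => //.
    by apply: measurableT_comp => //; exact: measurable_indic.
  - move=> x _; rewrite indicE lee_fin.
    by case: (_ \in _); rewrite ?normr1 ?normr0 ?powR1 ?powR0.
rewrite integral_cst//= mul1e /leb_Omega /mrestr setTI.
by rewrite lebesgue_measure_itv /= lte_fin ltr01 sube0 ltry.
Qed.

Definition indic_itv (R : realType) (a b : R) : L2 R :=
  Lfun_Sub (lee1n 2) (indic_Lfun (measurable_itv `[a, b[)).

(* Indices start at 0: the interval of particle i is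
   [m_0 + ... + m_(i-1), m_0 + ... + m_i). *)
Definition mass_before (R : realType) (N : nat) (m : 'I_N -> R) (i : 'I_N) : R :=
  \sum_(j < N | (j < i)%N) m j.

Definition step_fun (R : realType) (N : nat) (m x : 'I_N -> R) : L2 R :=
  \sum_(i < N) x i *: indic_itv (mass_before m i) (mass_before m i + m i).

(* Main.v *)
Require Import Defs.
From mathcomp Require Import all_boot all_order all_algebra.
From mathcomp Require Import all_classical all_reals all_analysis.
From mathcomp Require Import measurable_realfun.
From mathcomp Require Import ring lra.

(* Since H_{X(t)} decreases in time and H_{X(0)} consists of step functions, every X(t)
   takes finitely many values, and the projection on H_{X(t)} averages over the level
   sets of X(t). Put Z(t) := P_{H_{X(t)}}(F[X(t)]); then Z(t) < F[X(t)] in the convex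
   order by Jensen's inequality on each level set.

   At a collision time t_k let W_k := V(t_k-) - V(t_k). It is orthogonal to
   H_{X(t_k)}, hence to every X(t) with t >= t_k. For Y in K, let Q be the average of Y
   over the level sets of X(t_k). Then <W_k, Y> = <V(t_k-), Y - Q> is not positive:
   <X(t_k), Y - Q> = 0, whereas <X(s), Y - Q> >= 0 for s < t_k by Chebyshev's
   inequality on each level set. So W_k belongs to the subdifferential at X(t) for all
   t >= t_k.

   Between collisions dX/dt = V and dV/dt = Z, so that V(t1) + int_{t1}^{t} Z - V(t) is
   the sum of the W_k with t1 < t_k <= t, and
   X(t1) + (t2 - t1) V(t1) + int_{t1}^{t2} (t2 - s) Z(s) ds - X(t2) is the sum of the
   (t2 - t_k) W_k with t1 < t_k <= t2. This gives (i), (ii) and (iii). If F is sticking,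
   F[X(s)] - Z(s) belongs to the subdifferential at X(t) for all s <= t, hence so does
   its integral, and Z may be replaced by F[X].

   Identities in L^2 are tested against fixed functions, which reduces them to real
   calculus; Bochner integrals are limits of Riemann sums, which converge because L^2 is
   complete. *)

Set Implicit Arguments.
Unset Strict Implicit.
Unset Printing Implicit Defensive.
Import Order.TTheory GRing.Theory Num.Theory.
Import numFieldNormedType.Exports.
Local Open Scope classical_set_scope.
Local Open Scope ring_scope.

(** * The Hilbert space L^2(Omega) *)

Section Hilbert.
Variable R : realType.
Implicit Types (f g h : L2 R) (a : R).
Local Notation mu := (leb_Omega R).

Lemma L2_Lfun f : (f : _ -> R) \in Lfun mu 2%:R%:E.
Proof. exact: LfunP. Qed.

Lemma L2_measurable f : measurable_fun setT (f : measurableTypeR R -> R).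
Proof. by have /andP[/[!inE]] := L2_Lfun f. Qed.

Lemma inner_integrable f g : mu.-integrable setT (EFin \o (fun x => f x * g x)).
Proof. by apply/Lfun1_integrable/Lfun2_mul_Lfun1; exact: L2_Lfun. Qed.

Lemma innerC f g : inner f g = inner g f.
Proof. by rewrite /inner; under eq_Rintegral do rewrite mulrC. Qed.

Lemma innerDl f g h : inner (f + g) h = inner f h + inner g h.
Proof.
rewrite /inner -RintegralD//; try exact: inner_integrable.
by apply: eq_Rintegral => x _; rewrite /= mulrDl.
Qed.

Lemma innerZl a f h : inner (a *: f) h = a * inner f h.
Proof.
rewrite /inner -RintegralZl//; last exact: inner_integrable.
by apply: eq_Rintegral => x _; rewrite /= mulrA.
Qed.

Lemma inner0l h : inner 0 h = 0.
Proof. by rewrite -(scale0r (0 : L2 R)) innerZl mul0r. Qed.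

Lemma innerNl f h : inner (- f) h = - inner f h.
Proof. by rewrite -scaleN1r innerZl mulN1r. Qed.

Lemma innerBl f g h : inner (f - g) h = inner f h - inner g h.
Proof. by rewrite innerDl innerNl. Qed.

Lemma innerDr f g h : inner h (f + g) = inner h f + inner h g.
Proof. by rewrite innerC innerDl !(innerC h). Qed.

Lemma innerZr a f h : inner h (a *: f) = a * inner h f.
Proof. by rewrite innerC innerZl (innerC h). Qed.

Lemma inner0r h : inner h 0 = 0.
Proof. by rewrite innerC inner0l. Qed.

Lemma innerNr f h : inner h (- f) = - inner h f.
Proof. by rewrite innerC innerNl (innerC h). Qed.

Lemma innerBr f g h : inner h (f - g) = inner h f - inner h g.
Proof. by rewrite innerDr innerNr. Qed.

Lemma inner_suml (I : Type) (s : seq I) (P : pred I) (F : I -> L2 R) h :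
  inner (\sum_(i <- s | P i) F i) h = \sum_(i <- s | P i) inner (F i) h.
Proof.
by apply: (big_morph (fun f => inner f h)) => [f g|]; rewrite ?innerDl ?inner0l.
Qed.

Definition innerE := (innerDl, innerDr, innerBl, innerBr, innerNl, innerNr,
  innerZl, innerZr, inner0l, inner0r).

Lemma inner_ge0 f : 0 <= inner f f.
Proof. by apply: Rintegral_ge0 => x _; rewrite -expr2 sqr_ge0. Qed.

Lemma L2norm_ge0 f : 0 <= L2norm f.
Proof. by apply: fine_ge0; exact: Lnorm_ge0. Qed.

Lemma L2normE f : L2norm f ^+ 2 = inner f f.
Proof.
apply: EFin_inj; rewrite /inner /Rintegral fineK; last first.
  exact: (integrable_fin_num measurableT (inner_integrable f f)).
rewrite -(powR_mulrn 2 (L2norm_ge0 f)) -poweR_EFin /L2norm finite_norm_fine.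
rewrite poweR_Lnorm ?pnatr_eq0//.
apply: eq_integral => x _ /=.
by rewrite powR_mulrn ?normr_ge0// -normrX expr2 ger0_norm // -expr2 sqr_ge0.
Qed.

Lemma L2norm_sqrt f : L2norm f = Num.sqrt (inner f f).
Proof. by rewrite -L2normE sqrtr_sqr ger0_norm// L2norm_ge0. Qed.

Lemma normr_inner_le f g : `|inner f g| <= L2norm f * L2norm g.
Proof.
suff : inner f g ^+ 2 <= (L2norm f * L2norm g) ^+ 2.
  rewrite -(ler_sqr (x := `|_|)) ?nnegrE ?mulr_ge0 ?L2norm_ge0//.
  by rewrite real_normK ?num_real.
rewrite exprMn !L2normE.
have [g0|gn0] := eqVneq (inner g g) 0.
  have h (t : R) : 0 <= inner f f + 2 * t * inner f g.
    have := inner_ge0 (f + t *: g).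
    by rewrite !innerE g0 (innerC g f); lra.
  suff -> : inner f g = 0 by rewrite g0; lra.
  apply/eqP; apply/negPn/negP => n0.
  have := h (- (inner f f + 1) / (2 * inner f g)).
  rewrite (_ : 2 * _ * _ = - (inner f f + 1)); first lra.
  by field; exact: n0.
have gp : 0 < inner g g by rewrite lt_neqAle eq_sym gn0 inner_ge0.
(* This vector is the component of [f] orthogonal to [g], scaled by [inner g g]; its square is
   [inner g g] times the Cauchy-Schwarz defect. *)
have := inner_ge0 (inner g g *: f - inner f g *: g).
rewrite !innerE (innerC g f) => H.
have : 0 <= inner g g * (inner f f * inner g g - inner f g ^+ 2) by lra.
by rewrite pmulr_rge0// subr_ge0.
Qed.

Lemma inner_le f g : inner f g <= L2norm f * L2norm g.
Proof. exact: le_trans (ler_norm _) (normr_inner_le _ _). Qed.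

Lemma L2normD f g : L2norm (f + g) <= L2norm f + L2norm g.
Proof.
rewrite -ler_sqr ?nnegrE ?addr_ge0 ?L2norm_ge0// sqrrD !L2normE !innerE.
by have := inner_le f g; rewrite (innerC g f); lra.
Qed.

Lemma L2normZ a f : L2norm (a *: f) = `|a| * L2norm f.
Proof.
by rewrite !L2norm_sqrt !innerE mulrA -expr2 sqrtrM ?sqr_ge0// sqrtr_sqr.
Qed.

Lemma L2norm0 : L2norm (0 : L2 R) = 0.
Proof. by rewrite L2norm_sqrt inner0l sqrtr0. Qed.

Lemma L2normN f : L2norm (- f) = L2norm f.
Proof. by rewrite -scaleN1r L2normZ normrN1 mul1r. Qed.

Lemma L2distC f g : L2norm (f - g) = L2norm (g - f).
Proof. by rewrite -opprB L2normN. Qed.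

Lemma L2dist_triangle g f h : L2norm (f - h) <= L2norm (f - g) + L2norm (g - h).
Proof. by rewrite -[f - h](subrKA g) L2normD. Qed.

Lemma L2dist_dist f g : `|L2norm f - L2norm g| <= L2norm (f - g).
Proof.
have h1 := L2normD (f - g) g; rewrite subrK in h1.
have h2 := L2normD (g - f) f; rewrite subrK L2distC in h2.
by rewrite ler_norml; apply/andP; split; lra.
Qed.

Lemma L2norm_sum (I : Type) (s : seq I) (P : pred I) (F : I -> L2 R) :
  L2norm (\sum_(i <- s | P i) F i) <= \sum_(i <- s | P i) L2norm (F i).
Proof.
apply: (big_ind2 (fun f x => L2norm f <= x)) => //; first by rewrite L2norm0.
by move=> ? ? ? ? h1 h2; apply: le_trans (L2normD _ _) _; exact: lerD.
Qed.

(** Gives norm bounds by duality: an estimate linear in the test function is applied to [f] itself,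
    and one factor [L2norm f] cancels unless it is zero. *)
Lemma L2norm_le_inner f (c : R) : 0 <= c ->
  inner f f <= c * L2norm f -> L2norm f <= c.
Proof.
move=> c0; rewrite -L2normE expr2.
have [->//|n0] := eqVneq (L2norm f) 0.
by rewrite ler_pM2r// lt_neqAle eq_sym n0 L2norm_ge0.
Qed.

Lemma inner_eq0l f g : L2norm f = 0 -> inner f g = 0.
Proof.
move=> f0; apply/eqP; rewrite -normr_le0.
by apply: le_trans (normr_inner_le _ _) _; rewrite f0 mul0r.
Qed.

Lemma L2eq_innerl f g h : L2eq f g -> inner f h = inner g h.
Proof. by move=> /inner_eq0l e; apply/eqP; rewrite -subr_eq0 -innerBl e. Qed.

Lemma L2eq_ae f g : L2eq f g -> {ae mu, forall x, f x = g x}.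
Proof.
move=> /fine_Lnormr_eq0; apply: filterS => x /(_ I) /= /eqP.
by rewrite subr_eq0 => /eqP.
Qed.

Lemma ae_inner f g h (k : L2 R) : {ae mu, forall x, f x * g x = h x * k x} ->
  inner f g = inner h k.
Proof.
move=> e; rewrite /inner /Rintegral; congr fine.
apply: ae_eq_integral => //.
- by apply/measurable_EFinP/measurable_funM; exact: L2_measurable.
- by apply/measurable_EFinP/measurable_funM; exact: L2_measurable.
- by apply: filterS e => x e _ /=; rewrite e.
Qed.

Lemma ae_L2eq f g : {ae mu, forall x, f x = g x} -> L2eq f g.
Proof.
move=> e; rewrite /L2eq L2norm_sqrt (@ae_inner _ _ 0 0) ?inner0l ?sqrtr0//.
apply: filterS e => x e.
have -> : (f - g) x = f x - g x by [].
by rewrite e subrr !mul0r.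
Qed.

Lemma ae_inner_ge0 f g : {ae mu, forall x, 0 <= f x * g x} -> 0 <= inner f g.
Proof.
move=> e.
(* Passing to the absolute value changes the integrand on a null set only and makes it nonnegative
   everywhere. *)
suff -> : inner f g = \int[mu]_x `|f x * g x|.
  by apply: Rintegral_ge0 => x _; exact: normr_ge0.
rewrite /inner /Rintegral; congr fine.
have mfg : measurable_fun setT ((fun x => f x * g x) : measurableTypeR R -> R).
  by apply: measurable_funM; exact: L2_measurable.
apply: ae_eq_integral => //.
- exact/measurable_EFinP.
- by apply/measurable_EFinP; apply: measurableT_comp.
- by apply: filterS e => x e _ /=; rewrite ger0_norm.
Qed.

End Hilbert.

(** * Completeness of L^2(Omega) *)

Section Completeness.
Variable R : realType.
Implicit Types (f g h : L2 R).
Local Notation mu := (leb_Omega R).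
Local Notation T := (measurableTypeR R).

Lemma leb_OmegaT : mu setT = 1%E.
Proof.
by rewrite /leb_Omega /mrestr setTI lebesgue_measure_itv/= lte_fin ltr01 oppr0 adde0.
Qed.

Lemma Lfun2P (f : T -> R) : measurable_fun setT f ->
  (\int[mu]_x (f x ^+ 2)%:E < +oo)%E -> f \in Lfun mu 2%:R%:E.
Proof.
move=> mf ify; rewrite inE; apply/andP; split; first by rewrite inE.
rewrite inE /= /finite_norm unlock /Lnorm; apply: poweR_lty.
apply: le_lt_trans ify; rewrite le_eqVlt; apply/orP; left; apply/eqP.
by apply: eq_integral => x _ /=; rewrite powR_mulrn// -normrX ger0_norm// sqr_ge0.
Qed.

Lemma L2_integral_sqr f : (\int[mu]_x (f x ^+ 2)%:E = (L2norm f ^+ 2)%:E)%E.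
Proof.
rewrite L2normE /inner /Rintegral fineK; last first.
  exact: (integrable_fin_num measurableT (inner_integrable f f)).
by apply: eq_integral => x _; rewrite expr2.
Qed.

(** Hölder's inequality against the constant 1, whose norm is 1 because Omega has measure 1. *)
Lemma L1_le_L2 f : (\int[mu]_x `|f x|%:E <= (L2norm f)%:E)%E.
Proof.
have := @hoelder _ _ _ mu f (cst 1) 2 2 (L2_measurable f) (measurable_cst _).
rewrite Lnorm1 Lnorm_cst1.
rewrite [X in (_ * X)%E](_ : _ = 1%E); last first.
  transitivity ((1%E : \bar R) `^ 2^-1)%E; last exact: poweR1r.
  by congr poweR; exact: leb_OmegaT.
rewrite mule1 /L2norm finite_norm_fine.
have -> : EFin \o (f \* cst 1) = EFin \o f.
  by apply/funext => x /=; rewrite mulr1.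
by apply => //; lra.
Qed.

(** Riesz-Fischer argument: the increments are summable in L^1, hence absolutely summable almost
    everywhere, which yields a pointwise limit; Fatou's lemma upgrades it to a limit in norm. *)
Lemma L2_fast_cauchy (u : nat -> L2 R) :
  (forall n, L2norm (u n.+1 - u n) <= 2^-1 ^+ n) ->
  exists l, L2cvg u \oo l.
Proof.
move=> ufast.
pose d n := u n.+1 - u n.
have md n : measurable_fun setT (fun x : T => `|d n x|%:E).
  by apply/measurable_EFinP; apply: measurableT_comp => //; exact: L2_measurable.
pose H (x : T) := (\sum_(n <oo) `|d n x|%:E)%E.
have mH : measurable_fun setT H.
  by apply: ge0_emeasurable_sum => // n x _ _; rewrite lee_fin.
have Hint : mu.-integrable setT H.
  apply/integrableP; split => //.
  have H0 x : (0 <= H x)%E by apply: nneseries_ge0 => n _ _; rewrite lee_fin.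
  under eq_integral do rewrite gee0_abs//.
  rewrite integral_nneseries//.
  apply: (@le_lt_trans _ _ (\sum_(n <oo) (2^-1 ^+ n : R)%:E)%E).
    apply: lee_nneseries => // n _ => [_|].
      by apply: integral_ge0 => x _; rewrite lee_fin.
    by apply: le_trans (L1_le_L2 (d n)) _; rewrite lee_fin; exact: ufast.
  have /cvg_lim g2 : series (geometric (1 : R) 2^-1) n @[n --> \oo] --> (1 * (1 - 2^-1)^-1 : R).
    by apply: cvg_geometric_series; rewrite ger0_norm ?invr_ge0// invf_lt1// ltr1n.
  suff -> : (\sum_(n <oo) (2^-1 ^+ n : R)%:E = (1 * (1 - 2^-1)^-1 : R)%:E)%E by rewrite ltry.
  rewrite -g2// -EFin_lim.
    apply/congr_lim/funext => n /=.
    by rewrite /series /geometric /= -sumEFin; apply: eq_bigr => i _; rewrite mul1r.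
  by apply: is_cvg_geometric_series; rewrite ger0_norm ?invr_ge0// invf_lt1// ltr1n.
pose D := [set x | H x \is a fin_num].
have mD : measurable (D : set T).
  rewrite -[D]setTI; exact: emeasurable_fin_num.
have aeD : {ae mu, forall x, D x}.
  by have := integrable_ae measurableT Hint; apply: filterS => x; apply.
have cvgD x : D x -> cvgn (fun n => u n x).
  move=> Dx.
  have cs : cvgn (series (fun n => d n x)).
    apply: normed_cvg; apply: nondecreasing_is_cvgn.
      by apply/nondecreasing_seqP => n; rewrite -subr_ge0 seriesSB normr_ge0.
    exists (fine (H x)) => _ [n _ <-].
    rewrite -lee_fin fineK// /series /= -sumEFin.
    apply: nneseries_lim_ge => k _ _; rewrite lee_fin.
    exact: normr_ge0.
  have -> : (fun n => u n x) = (fun n => u 0%N x + series (fun n => d n x) n).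
    apply/funext; elim=> [|n IH].
      by rewrite /series /= big_geq// addr0.
    rewrite seriesSr addrA -IH.
    by have -> : d n x = u n.+1 x - u n x by []; rewrite addrC subrK.
  by apply: is_cvgD => //; exact: is_cvg_cst.
(* The value 0 off [D] makes [l] the everywhere limit of [u n] times the indicator of [D], hence
   measurable. *)
pose l (x : T) := if x \in D then limn (fun n => u n x) else 0.
have ul x : D x -> u n x @[n --> \oo] --> l x.
  by move=> Dx; rewrite /l mem_set//; exact: cvgD.
have ml : measurable_fun setT l.
  apply: (@measurable_fun_cvg _ _ _ setT (fun n x => u n x * \1_D x)).
    by move=> n; apply: measurable_funM; [exact: L2_measurable|exact: measurable_indic].
  move=> x _; have [Dx|nDx] := pselect (D x).
    by rewrite indicE mem_set//=; under eq_fun do rewrite mulr1; exact: ul.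
  rewrite indicE memNset//=; under eq_fun do rewrite mulr0.
  by rewrite /l memNset//; exact: cvg_cst.
have tail n k : L2norm (u (n + k)%N - u n) <= 2 * 2^-1 ^+ n - 2 * 2^-1 ^+ (n + k).
  elim: k => [|k IH]; first by rewrite addn0 !subrr L2norm0.
  apply: le_trans (L2dist_triangle (u (n + k)%N) _ _) _.
  rewrite addnS exprS; move: IH (ufast (n + k)%N); lra.
(* Fatou in [k] for the squares of [u (n + k) - u n], whose norms are bounded by the geometric
   tail. *)
have fatou_n n : (\int[mu]_x ((l x - u n x) ^+ 2)%:E <= ((2 * 2^-1 ^+ n) ^+ 2)%:E)%E.
  have mk k : measurable_fun setT (fun x : T => ((u (n + k)%N x - u n x) ^+ 2)%:E).
    apply/measurable_EFinP; apply: measurable_funX.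
    by apply: measurable_funB; exact: L2_measurable.
  have := @fatou _ _ _ mu setT measurableT _ mk.
  move=> /(_ (fun k x _ => _)) Hf.
  apply: (@le_trans _ _ (\int[mu]_x limn_einf (fun k => ((u (n + k)%N x - u n x) ^+ 2)%:E))%E).
    rewrite le_eqVlt; apply/orP; left; apply/eqP.
    apply: ae_eq_integral => //.
    - by apply/measurable_EFinP; apply: measurable_funX; apply: measurable_funB => //;
        exact: L2_measurable.
    - apply: measurableT_comp => //.
      by apply: measurable_fun_limn_esup => k; apply: measurableT_comp => //; exact: mk.
    - apply: filterS aeD => x Dx _ /=.
      have c : (fun k => ((u (n + k)%N x - u n x) ^+ 2)%:E) @ \oo --> ((l x - u n x) ^+ 2)%:E.
        apply: cvg_EFin; first by apply: nearW.
        have c1 : (fun k => u (n + k)%N x - u n x) @ \oo --> (l x - u n x).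
          apply: cvgB; last exact: cvg_cst.
          have := ul x Dx; rewrite -(cvg_shiftn n).
          by under eq_fun do rewrite addnC.
        rewrite expr2; under eq_fun do rewrite /= expr2.
        exact: cvgM.
      by rewrite (cvg_limn_einf_sup c).1.
  apply: le_trans (Hf _) _; first by move=> k x; rewrite lee_fin sqr_ge0.
  rewrite limn_einf_lim; apply: lime_le; first exact: is_cvg_einfs.
  apply: nearW => k.
  apply: (@le_trans _ _ (\int[mu]_x ((u (n + k)%N x - u n x) ^+ 2)%:E)%E).
    by apply: ereal_inf_lbound; exists k => /=.
  rewrite (L2_integral_sqr (u (n + k)%N - u n)) lee_fin.
  rewrite lerXn2r ?nnegrE ?L2norm_ge0// ?mulr_ge0 ?exprn_ge0 ?invr_ge0//.
  apply: le_trans (tail n k) _.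
  by rewrite gerBl mulr_ge0// exprn_ge0// invr_ge0.
have lL n : (fun x => l x - u n x) \in Lfun mu 2%:R%:E.
  apply: Lfun2P; first by apply: measurable_funB => //; exact: L2_measurable.
  by apply: le_lt_trans (fatou_n n) _; rewrite ltry.
(* Square integrability is established for the differences [l - u n]; adding [u 0] back gives [l] as
   an element of [L2 R]. *)
pose L : L2 R := Lfun_Sub (lee1n 2) (lL 0%N) + u 0%N.
have Lx x : L x = l x.
  have -> : L x = l x - u 0%N x + u 0%N x by [].
  by rewrite subrK.
exists L; apply/cvgrPdist_le => e e0.
have [n0 _ Hn0] : \forall n \near \oo, 2 * 2^-1 ^+ n <= e.
  have : geometric (2 : R) 2^-1 @ \oo --> (0 : R).
    by apply: cvg_geometric; rewrite ger0_norm ?invr_ge0// invf_lt1// ltr1n.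
  move=> /cvgrPdist_le /(_ e e0); apply: filterS => n /=.
  by rewrite sub0r normrN; apply: le_trans; exact: ler_norm.
exists n0 => // n /= /Hn0 /= ne.
rewrite sub0r normrN ger0_norm ?L2norm_ge0//; apply: le_trans ne.
rewrite L2distC -(ler_pXn2r (n:=2))// ?nnegrE ?L2norm_ge0// ?mulr_ge0 ?exprn_ge0 ?invr_ge0//.
rewrite -lee_fin -L2_integral_sqr; apply: le_trans (fatou_n n).
rewrite le_eqVlt; apply/orP; left; apply/eqP; apply: eq_integral => x _.
by have -> : (L - u n) x = L x - u n x by []; rewrite Lx.
Qed.

Lemma L2_complete (u : nat -> L2 R) :
  (forall e : R, 0 < e -> exists n0, forall m n, (n0 <= m)%N -> (n0 <= n)%N ->
     L2norm (u m - u n) <= e) ->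
  exists l, L2cvg u \oo l.
Proof.
move=> uC.
have /choice[N HN] : forall k, exists n0, forall m n, (n0 <= m)%N -> (n0 <= n)%N ->
    L2norm (u m - u n) <= 2^-1 ^+ k.
  by move=> k; apply: uC; rewrite exprn_gt0// invr_gt0.
(* Partial sums of the Cauchy thresholds are nondecreasing and dominate each [N k], so [u \o p] is
   fast Cauchy. *)
pose p k := (\sum_(i < k.+1) N i)%N.
have Np k : (N k <= p k)%N by rewrite /p big_ord_recr /= leq_addl.
have pS k : (p k <= p k.+1)%N by rewrite /p [leqRHS]big_ord_recr /= leq_addr.
have [l ul] : exists l, L2cvg (u \o p) \oo l.
  apply: L2_fast_cauchy => n /=; apply: HN => //.
  exact: leq_trans (pS _).
exists l; apply/cvgrPdist_le => e e0.
have e20 : 0 < e / 2 by rewrite divr_gt0.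
have [n0 Hn0] := uC _ e20.
move/cvgrPdist_le : ul => /(_ _ e20) [k0 _ Hk0].
have [k1 _ Hk1] : \forall k \near \oo, 2^-1 ^+ k <= e / 2.
  have : geometric (1 : R) 2^-1 @ \oo --> (0 : R).
    by apply: cvg_geometric; rewrite ger0_norm ?invr_ge0// invf_lt1// ltr1n.
  move=> /cvgrPdist_le /(_ _ e20); apply: filterS => n /=.
  by rewrite sub0r normrN mul1r; apply: le_trans; exact: ler_norm.
pose k := maxn k0 k1.
exists (N k) => // m /= Nm.
rewrite sub0r normrN ger0_norm ?L2norm_ge0//.
apply: le_trans (L2dist_triangle (u (p k)) _ _) _.
rewrite [leRHS]splitr; apply: lerD.
  apply: le_trans (HN k _ _ Nm (Np k)) _.
  by apply: Hk1 => /=; exact: leq_maxr.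
have := Hk0 k (leq_maxl _ _).
by rewrite sub0r normrN ger0_norm ?L2norm_ge0.
Qed.

End Completeness.

(** * Real calculus with finitely many exceptional points *)

Section ScalarCalculus.
Variable R : realType.
Implicit Types (g z k d : R -> R) (a b M : R) (D : seq R).
Local Notation leb := (@lebesgue_measure R).

Lemma continuous_within_sub (A B : set R) g : A `<=` B ->
  {within B, continuous g} -> {within A, continuous g}.
Proof. by move=> AB; exact: continuous_subspaceW. Qed.

(* The exceptional points are removed one at a time by splitting the interval. *)
Lemma piecewise_le_MVT D a b g d M : a <= b ->
  {within `[a, b], continuous g} ->
  (forall t, a < t < b -> t \notin D -> is_derive t 1 g (d t) /\ d t <= M) ->
  g b - g a <= M * (b - a).
Proof.
elim: D a b => [|e D IH] a b ab cg dg.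
  move: ab; rewrite le_eqVlt => /predU1P[->|ab]; first by rewrite !subrr mulr0.
  have [c cab ->] := @MVT R g d a b ab (fun x xab => (dg x xab isT).1) cg.
  by rewrite ler_wpM2r ?subr_ge0 ?(ltW ab)//; apply: (dg c _ _).2.
have [/andP[ae eb]|nab] := boolP (a < e < b).
  have h1 : g e - g a <= M * (e - a).
    apply: IH; [exact: ltW| |].
      apply: continuous_within_sub cg => x /=; rewrite !in_itv /= => /andP[-> xe] /=.
      by rewrite (le_trans xe)// ltW.
    move=> t /andP[at_ te] tD; apply: dg; first by rewrite at_ (lt_trans te).
    by rewrite in_cons negb_or tD andbT; rewrite lt_eqF.
  have h2 : g b - g e <= M * (b - e).
    apply: IH; [exact: ltW| |].
      apply: continuous_within_sub cg => x /=; rewrite !in_itv /= => /andP[ex ->].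
      by rewrite (le_trans (ltW ae)).
    move=> t /andP[et tb] tD; apply: dg; first by rewrite tb (lt_trans ae).
    by rewrite in_cons negb_or tD andbT; rewrite gt_eqF.
  by rewrite -(subrKA e (g b)); nra.
apply: IH => // t tab tD; apply: dg => //.
rewrite in_cons negb_or tD andbT; apply: contra nab => /eqP <-; exact: tab.
Qed.

Lemma piecewise_cst D a b g : a <= b ->
  {within `[a, b], continuous g} ->
  (forall t, a < t < b -> t \notin D -> is_derive t 1 g 0) -> g a = g b.
Proof.
move=> ab cg dg; apply/eqP; rewrite eq_le.
have h1 := @piecewise_le_MVT D a b g (cst 0) 0 ab cg
  (fun t tab tD => conj (dg t tab tD) (lexx _)).
have cNg : {within `[a, b], continuous (- g)}.
  by move=> x; apply: continuousN; exact: cg.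
have h2 := @piecewise_le_MVT D a b (- g) (cst 0) 0 ab cNg.
have {h2}: (- g) b - (- g) a <= 0 * (b - a).
  apply: h2 => t tab tD; split=> //=.
  by have := is_deriveN (dg t tab tD); rewrite oppr0.
have -> : (- g) b = - g b by []. have -> : (- g) a = - g a by [].
move: h1; rewrite !mul0r => ? ?; apply/andP; split; lra.
Qed.

Lemma set_seq_bigcup D : [set` D] = \bigcup_(x in [set` D]) [set x].
Proof. by apply/seteqP; split=> [x xD|x [y yD ->]]//; exists x. Qed.

Lemma measurable_seq D : measurable ([set` D] : set (measurableTypeR R)).
Proof. by rewrite set_seq_bigcup; apply: fin_bigcup_measurable. Qed.

Lemma closed_seq D : closed [set` D].
Proof.
rewrite set_seq_bigcup.
by apply: closed_bigcup => [|x _]; [exact: finite_seq|exact: closed_eq].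
Qed.

Lemma ae_notin_seq D : {ae leb, forall t, t \notin D}.
Proof.
exists [set` D]; split; first exact: measurable_seq.
  by apply: countable_lebesgue_measure0; exact: finite_set_countable.
by move=> t /= /negP; rewrite negbK.
Qed.

Lemma ae_lebS (P Q : R -> Prop) : (forall t, P t -> Q t) ->
  {ae leb, forall t, P t} -> {ae leb, forall t, Q t}.
Proof.
move=> PQ [A [mA A0 sA]]; exists A; split => //.
by apply: subset_trans sA => t /= nQ Pt; apply/nQ/PQ.
Qed.

Lemma measurable_fun_seq D z : measurable_fun [set` D] (z : measurableTypeR R -> R).
Proof.
move=> _ Y mY.
have fD : finite_set ([set` D] `&` z @^-1` Y).
  exact: finite_setIl.
have [s ->] : exists s : seq R, [set` D] `&` z @^-1` Y = [set` s].
  by move/finite_seqP : fD.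
exact: measurable_seq.
Qed.

(** The function is continuous on the open set left after removing [a], [b] and [D]; on the finite
    remainder every function is measurable. *)
Lemma piecewise_cont_measurable D a b z :
  (forall t, a < t < b -> t \notin D -> {for t, continuous z}) ->
  measurable_fun `[a, b] (z : measurableTypeR R -> R).
Proof.
move=> cz.
have oU : open (`]a, b[ `&` ~` [set` D]).
  apply: openI; first exact: interval_open.
  by apply: closed_openC; exact: closed_seq.
have mU : measurable_fun (`]a, b[ `&` ~` [set` D]) (z : measurableTypeR R -> R).
  apply: open_continuous_measurable_fun => // t; rewrite inE => -[/= tab /negP tD].
  by apply: cz => //; rewrite in_itv in tab.
have mV : measurable_fun ((`]a, b[ `&` ~` [set` D]) `|` [set` [:: a, b & D]])
    (z : measurableTypeR R -> R).
  apply/measurable_funU; [exact: open_measurable|exact: measurable_seq|].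
  by split => //; exact: measurable_fun_seq.
apply: measurable_funS mV.
  by apply: measurableU; [exact: open_measurable|exact: measurable_seq].
move=> t /=; rewrite in_itv /= => /andP[at_ tb].
have [tD|tD] := boolP (t \in [:: a, b & D]); [by right|left].
move: tD; rewrite !in_cons !negb_or => /and3P[ta tb' /negP tD]; split=> //=.
by rewrite in_itv /= !lt_neqAle at_ tb tb' eq_sym ta.
Qed.

Lemma piecewise_integrable D a b z M :
  (forall t, a < t < b -> t \notin D -> {for t, continuous z}) ->
  (forall t, a <= t <= b -> `|z t| <= M) ->
  leb.-integrable `[a, b] (EFin \o z).
Proof.
move=> cz zM; apply: measurable_bounded_integrable => //.
- rewrite [X in (X < _)%E](_ : _ = leb `[a, b]%classic)// lebesgue_measure_itv /=.
  by case: ifP; rewrite ?ltry.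
- exact: (@piecewise_cont_measurable D).
- exists M; split; first exact: num_real.
  by move=> x Mx t /=; rewrite in_itv /= => /zM /le_trans; apply; exact: ltW.
Qed.

(** [g] minus the indefinite integral of [z] is continuous with zero derivative off [D], hence
    constant; continuity of [g] across [D] is what excludes jump terms. *)
Lemma piecewise_FTC D a b g z M : a <= b ->
  {within `[a, b], continuous g} ->
  (forall t, a < t < b -> t \notin D ->
     is_derive t 1 g (z t) /\ {for t, continuous z}) ->
  (forall t, a <= t <= b -> `|z t| <= M) ->
  \int[leb]_(t in `[a, b]) z t = g b - g a.
Proof.
move=> ab cg dg zM.
have iz : leb.-integrable `[a, b] (EFin \o z).
  by apply: (@piecewise_integrable D _ _ _ M) => // t tab tD; case: (dg t tab tD).
pose P x := \int[leb]_(t in `[a, x]) z t.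
have cP : {within `[a, b], continuous P}.
  exact: parameterized_integral_continuous.
have cst : (g - P) a = (g - P) b.
  apply: (@piecewise_cst D) => //.
    by move=> x; apply: cvgB; [exact: cg|exact: cP].
  move=> t tab tD; have [dgt czt] := dg t tab tD.
  move: (tab) => /andP[at_ tb].
  have [dP P't] := @continuous_FTC1_closed R z a t b tb iz at_ czt.
  have dPt : is_derive t 1 P (z t).
    by apply: (DeriveDef dP); rewrite -derive1E; exact: P't.
  by have := is_deriveB dgt dPt; rewrite subrr.
move: cst; rewrite /P.
have -> : (g - P) a = g a - P a by []. have -> : (g - P) b = g b - P b by [].
by rewrite /P set_itv1 Rintegral_set1; lra.
Qed.

End ScalarCalculus.

(** * Curves in L^2(Omega) and their Bochner integrals *)

Section Curves.
Variable R : realType.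
Implicit Types (f g h : L2 R) (X V Z : R -> L2 R) (a b M t : R) (D : seq R).
Local Notation leb := (@lebesgue_measure R).

Lemma L2cvgP (I : Type) (F : set_system I) {FF : Filter F} (u : I -> L2 R) l :
  L2cvg u F l <-> forall e, 0 < e -> \forall i \near F, L2norm (u i - l) <= e.
Proof.
split=> [/cvgrPdist_le H e /H|H].
  by apply: filterS => i; rewrite sub0r normrN ger0_norm ?L2norm_ge0.
apply/cvgrPdist_le => e /H.
by apply: filterS => i; rewrite sub0r normrN ger0_norm ?L2norm_ge0.
Qed.

Lemma L2cvg_inner (I : Type) (F : set_system I) {FF : Filter F} (u : I -> L2 R) l h :
  L2cvg u F l -> inner (u i) h @[i --> F] --> inner l h.
Proof.
move=> ul; apply/cvgrPdist_le => /= e e0.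
have h1 : 0 < L2norm h + 1 by rewrite ltr_wpDl ?L2norm_ge0.
have /L2cvgP /(_ (e / (L2norm h + 1))) := ul.
rewrite divr_gt0// => /(_ isT); apply: filterS => i ui.
rewrite -innerBl /=.
apply: (le_trans (normr_inner_le (l - u i) h)); rewrite L2distC.
rewrite -[leRHS](divfK (lt0r_neq0 h1)).
by apply: ler_pM; rewrite ?L2norm_ge0// lerDl.
Qed.

Lemma L2cvg_norm (I : Type) (F : set_system I) {FF : Filter F} (u : I -> L2 R) l :
  L2cvg u F l -> L2norm (u i) @[i --> F] --> L2norm l.
Proof.
move=> ul; apply/cvgrPdist_le => /= e e0.
have /L2cvgP /(_ e e0) := ul; apply: filterS => i ui.
by apply: le_trans (L2dist_dist _ _) _; rewrite L2distC.
Qed.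

Lemma L2cvgZ (I : Type) (F : set_system I) {FF : Filter F} (c : I -> R) (c0 : R)
    (u : I -> L2 R) l :
  c i @[i --> F] --> c0 -> L2cvg u F l -> L2cvg (fun i => c i *: u i) F (c0 *: l).
Proof.
move=> cc ul.
have b : `|c i| * L2norm (u i - l) + `|c i - c0| * L2norm l @[i --> F] -->
    `|c0| * 0 + `|c0 - c0| * L2norm l.
  apply: cvgD; first by apply: cvgM => //; exact: cvg_norm.
  apply: cvgM; last exact: cvg_cst.
  by apply: cvg_norm; apply: cvgB => //; exact: cvg_cst.
rewrite mulr0 subrr normr0 mul0r addr0 in b.
apply: squeeze_cvgr b; last exact: cvg_cst.
apply: nearW => i; rewrite L2norm_ge0 /=.
have -> : c i *: u i - c0 *: l = c i *: (u i - l) + (c i - c0) *: l.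
  by rewrite scalerBr scalerBl addrA subrK.
by rewrite -!L2normZ L2normD.
Qed.

Lemma L2cvg_finer (I : Type) (F G : set_system I) (u : I -> L2 R) l :
  F `<=` G -> L2cvg u F l -> L2cvg u G l.
Proof. by move=> FG H P /H; exact: FG. Qed.

Lemma L2cvg_within_sub (A B : set R) X (F : set_system R) l : Filter F ->
  (\forall s \near F, A s -> B s) ->
  L2cvg X (within B F) l -> L2cvg X (within A F) l.
Proof.
by move=> FF AB; apply: L2cvg_finer => P; apply: filterS2 AB => s ? ? ?; auto.
Qed.

Lemma deriv_within_sub (A B : set R) X t f :
  (\forall s \near t, A s -> B s) ->
  deriv_within B X t f -> deriv_within A X t f.
Proof.
move=> AB; apply: L2cvg_within_sub; rewrite near_withinE.
by apply: filterS AB => s + _.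
Qed.

(** Near [t] the difference quotients have norm at most [L2norm f + 1], so the increment is of order
    [s - t]. *)
Lemma deriv_within_cvg (A : set R) X t f : deriv_within A X t f ->
  L2cvg X (within A (nbhs t)) (X t).
Proof.
move=> /L2cvgP /(_ 1 ltr01); rewrite !near_withinE => H.
apply/L2cvgP => e e0; rewrite near_withinE.
have f1 : 0 < L2norm f + 1 by rewrite ltr_wpDl ?L2norm_ge0.
have near_t : \forall s \near t, `|s - t| <= e / (L2norm f + 1).
  have d0 : 0 < e / (L2norm f + 1) by rewrite divr_gt0.
  apply/nbhs_ballP; exists (e / (L2norm f + 1)) => // s.
  by rewrite /ball /= distrC => /ltW.
apply: filterS2 H near_t => s H st As.
have [->|s_t] := eqVneq s t; first by rewrite subrr L2norm0 ltW.
have := H s_t As; set q := _ *: _ => qf.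
have -> : X s - X t = (s - t) *: q by rewrite scalerA divff ?scale1r ?subr_eq0.
rewrite L2normZ -[leRHS](divfK (lt0r_neq0 f1)).
apply: ler_pM; rewrite ?L2norm_ge0//.
have := L2normD (q - f) f; rewrite subrK; lra.
Qed.

(** Reduces vector calculus to real calculus. The work lies in the change of variable between
    quotients in [s - t] and the quotients at 0 that define [is_derive]. *)
Lemma time_deriv_inner X t f h :
  time_deriv X t f -> is_derive t 1 (fun s => inner (X s) h) (inner f h).
Proof.
move=> Xt.
have cv : (fun s => s^-1 *: (inner (X (s *: 1 + t)) h - inner (X t) h)) @ 0^' -->
    inner f h.
  have c1 : inner ((s - t)^-1 *: (X s - X t)) h @[s --> within setT (dnbhs t)] --> inner f h.
    exact: L2cvg_inner.
  apply/cvgrPdist_le => /= e e0; move/cvgrPdist_le : c1 => /(_ e e0).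
  rewrite /within /= !near_withinE => /nbhs_ballP [d /= d0 H].
  apply/nbhs_ballP; exists d => //= s sd s0.
  have := H (s *: 1 + t); rewrite /= innerZl innerBl.
  have -> : s *: 1 + t - t = s by rewrite addrK; exact: mulr1.
  apply => //.
    move: sd; rewrite /ball /= sub0r normrN => sd.
    by rewrite opprD addrCA subrr addr0 normrN [_ *: _]mulr1.
  by rewrite -subr_eq0 addrK [_ *: _]mulr1.
by apply: DeriveDef; [apply/cvg_ex; exists (inner f h)|exact/cvg_lim].
Qed.

Lemma L2_continuous_inner X a b h : 0 <= a -> L2_continuous X ->
  {within `[a, b], continuous (fun s => inner (X s) h)}.
Proof.
move=> a0 cX; apply/subspace_continuousP => t /=; rewrite in_itv /= => /andP[at_ tb].
have t0 := le_trans a0 at_.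
apply: L2cvg_inner; apply: L2cvg_within_sub (cX t t0); apply: nearW => s /=.
by rewrite !in_itv /= => /andP[as_ _]; rewrite (le_trans a0).
Qed.

(** The scalar mean value inequality is applied to the pairing with the increment [X b - X a]
    itself. *)
Lemma piecewise_L2_MVT D X V a b M : a <= b -> 0 <= M ->
  (forall h, {within `[a, b], continuous (fun s => inner (X s) h)}) ->
  (forall t, a < t < b -> t \notin D -> time_deriv X t (V t) /\ L2norm (V t) <= M) ->
  L2norm (X b - X a) <= M * (b - a).
Proof.
move=> ab M0 cX dX.
apply: L2norm_le_inner; first by rewrite mulr_ge0// subr_ge0.
set h := X b - X a; rewrite {1}/h innerBl.
rewrite mulrAC; apply: (@piecewise_le_MVT _ D _ _ (fun s => inner (X s) h)
   (fun s => inner (V s) h)) => //.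
move=> t tab tD; have [dt Vt] := dX t tab tD; split.
  exact: time_deriv_inner.
by apply: le_trans (inner_le _ _) _; rewrite ler_wpM2r// L2norm_ge0.
Qed.

End Curves.

(** * Simple functions, Riemann sums and existence of Bochner integrals *)

Section Bochner.
Variable R : realType.
Implicit Types (f g h : L2 R) (Z : R -> L2 R) (a b M t : R) (D : seq R) (S : tsimple R).
Local Notation leb := (@lebesgue_measure R).
Local Notation T := (measurableTypeR R).

Lemma itv_lty a b : (leb `[a, b]%classic < +oo)%E.
Proof. by rewrite lebesgue_measure_itv /=; case: ifP; rewrite ?ltry. Qed.

Lemma ts_fun_inner S t h :
  inner (ts_fun S t) h = \sum_(i < ts_size S) \1_(ts_set i) t * inner (ts_val i) h.
Proof. by rewrite /ts_fun inner_suml; under eq_bigr do rewrite innerZl. Qed.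

Lemma integrable_indicZ a b S (i : 'I_(ts_size S)) (c : R) :
  leb.-integrable `[a, b] (fun t => (\1_(ts_set i) t * c)%:E).
Proof.
have -> : (fun t => (\1_(ts_set i) t * c)%:E) = EFin \o (fun t : T => \1_(ts_set i) t * c) by [].
apply: measurable_bounded_integrable => //.
- exact: itv_lty.
- by apply: measurable_funM => //; exact: measurable_indic (ts_measurable i).
- exists `|c|; split; first exact: num_real.
  move=> x cx t _ /=; rewrite normrM indicE; apply: le_trans (ltW cx).
  by case: (_ \in _); rewrite ?normr1 ?normr0 ?mul1r ?mul0r.
Qed.

Lemma integrable_ts_fun a b S h :
  leb.-integrable `[a, b] (fun t => (inner (ts_fun S t) h)%:E).
Proof.
have -> : (fun t => (inner (ts_fun S t) h)%:E) =
    (fun t => (\sum_(i < ts_size S) (\1_(ts_set i) t * inner (ts_val i) h)%:E)%E).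
  by apply/funext => t; rewrite ts_fun_inner sumEFin.
by apply: integrable_sum => // i _; exact: integrable_indicZ.
Qed.

Lemma inner_ts_integral a b S h :
  inner (ts_integral a b S) h = \int[leb]_(t in `[a, b]) inner (ts_fun S t) h.
Proof.
suff e : (\int[leb]_(t in `[a, b]) (inner (ts_fun S t) h)%:E)%E =
    (inner (ts_integral a b S) h)%:E by rewrite [RHS]/Rintegral e.
rewrite /ts_integral inner_suml -sumEFin.
transitivity (\int[leb]_(t in `[a, b])
    (\sum_(i < ts_size S) (\1_(ts_set i) t * inner (ts_val i) h)%:E))%E.
  by apply: eq_integral => t _; rewrite ts_fun_inner sumEFin.
rewrite integral_sum//; last by move=> i; exact: integrable_indicZ.
apply: eq_bigr => i _.
under eq_integral do rewrite EFinM.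
rewrite integralZr//; last first.
  have -> : (fun t : T => (\1_(ts_set i) t : R)%:E) =
      (fun t => (\1_(ts_set i) t * 1 : R)%:E).
    by apply/funext => t; rewrite mulr1.
  exact: integrable_indicZ.
rewrite integral_indic//; last exact: ts_measurable.
rewrite innerZl EFinM; congr (_ * _)%E; rewrite fineK//.
have mI : measurable (ts_set i `&` `[a, b] : set T).
  by apply: measurableI => //; exact: ts_measurable.
rewrite ge0_fin_numE//; apply: le_lt_trans (itv_lty a b).
by apply: le_measure; rewrite ?inE//; exact: subIsetr.
Qed.

(** Expanding the squared distance leaves the squared norm of [Z t], its pairings with the finitely
    many values of [S], and indicators. *)
Lemma measurable_dist_ts_fun (A : set T) Z S : measurable A ->
  (forall h, measurable_fun A (fun t : T => inner (Z t) h)) ->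
  measurable_fun A (fun t : T => inner (Z t) (Z t)) ->
  measurable_fun A (fun t : T => L2norm (Z t - ts_fun S t)).
Proof.
move=> mA mZ mZZ.
have -> : (fun t : T => L2norm (Z t - ts_fun S t)) =
    (fun t => Num.sqrt (inner (Z t - ts_fun S t) (Z t - ts_fun S t))).
  by apply/funext => t; rewrite L2norm_sqrt.
apply: (measurableT_comp (f := @Num.sqrt R)).
  by apply: continuous_measurable_fun; exact: sqrt_continuous.
have -> : (fun t : T => inner (Z t - ts_fun S t) (Z t - ts_fun S t)) =
  (fun t : T => inner (Z t) (Z t) -
     2 * \sum_(i < ts_size S) \1_(ts_set i) t * inner (Z t) (ts_val i) +
     \sum_(i < ts_size S) \sum_(j < ts_size S)
        \1_(ts_set i) t * (\1_(ts_set j) t * inner (ts_val i) (ts_val j))).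
  apply/funext => t; rewrite !innerE (innerC (Z t) (ts_fun S t)).
  rewrite !ts_fun_inner (eq_bigr (fun i => \1_(ts_set i) t * inner (Z t) (ts_val i))); last first.
    by move=> i _; rewrite innerC.
  have -> : \sum_(i < ts_size S) \1_(ts_set i) t * inner (ts_val i) (ts_fun S t) =
    \sum_(i < ts_size S) \sum_(j < ts_size S)
        \1_(ts_set i) t * (\1_(ts_set j) t * inner (ts_val i) (ts_val j)).
    apply: eq_bigr => i _; rewrite innerC ts_fun_inner mulr_sumr.
    by apply: eq_bigr => j _; rewrite (innerC (ts_val j)).
  by ring.
have mi (i : 'I_(ts_size S)) : measurable_fun A (\1_(ts_set i) : T -> R).
  by apply: measurable_indic; exact: ts_measurable.
apply: measurable_funD.
  apply: measurable_funB => //; apply: measurable_funM => //.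
  by apply: measurable_sum => i; apply: measurable_funM.
apply: measurable_sum => i; apply: measurable_sum => j.
by apply: measurable_funM => //; apply: measurable_funM.
Qed.

Lemma ts_fun_bounded S : exists B : R, forall t, L2norm (ts_fun S t) <= B.
Proof.
exists (\sum_(i < ts_size S) L2norm (ts_val i)) => t.
apply: (le_trans (L2norm_sum _ _ _)); apply: ler_sum => i _.
rewrite L2normZ indicE; case: (_ \in _); rewrite ?normr1 ?mul1r//.
by rewrite normr0 mul0r L2norm_ge0.
Qed.

(** Sampling at left end points of [n.+1] equal cells; [n.+1] keeps the mesh well defined at
    [n = 0], and the half-open cells do not cover [b]. *)
Definition riemann_ts a b Z (n : nat) : tsimple R :=
  @TSimple R n.+1
    (fun i => `[a + i%:R * ((b - a) / n.+1%:R), a + i.+1%:R * ((b - a) / n.+1%:R)[%classic)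
    (fun i => Z (a + i%:R * ((b - a) / n.+1%:R)))
    (fun i => measurable_itv _).

Lemma riemann_ts_val a b Z n t : a <= t -> t < b ->
  exists t', [/\ a <= t', t' <= t, t - t' <= (b - a) / n.+1%:R &
    ts_fun (riemann_ts a b Z n) t = Z t'].
Proof.
move=> at_ tb; set d := (b - a) / n.+1%:R.
have d0 : 0 < d by rewrite divr_gt0// subr_gt0 (le_lt_trans at_).
have memE (i : nat) : (a + i%:R * d <= t < a + i.+1%:R * d) = (i%:R <= (t - a) / d < i.+1%:R).
  by rewrite ler_pdivlMr// ltr_pdivrMr// lerBrDl ltrBlDl.
have x0 : 0 <= (t - a) / d by rewrite divr_ge0 ?subr_ge0// ltW.
(* The integer part of the rescaled time is the index of the unique cell containing [t]. *)
pose k := Num.trunc ((t - a) / d).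
have kP := trunc_itv x0; rewrite -/k in kP.
have kn : (k < n.+1)%N.
  rewrite -(ltr_nat R); apply: (@le_lt_trans _ _ ((t - a) / d)); first by case/andP: kP.
  rewrite ltr_pdivrMr// /d mulrCA divff ?mulr1 ?pnatr_eq0//; lra.
exists (a + k%:R * d).
have : a + k%:R * d <= t < a + k.+1%:R * d by rewrite memE.
move=> /andP[h1 h2]; split => //.
- by rewrite lerDl mulr_ge0// ltW.
- by move: h2; rewrite -natr1 mulrDl mul1r; lra.
rewrite /ts_fun (bigD1 (Ordinal kn))//= big1 ?addr0.
  by rewrite indicE mem_set ?scale1r// /= in_itv /= -/d h1 h2.
move=> i ik; rewrite indicE memNset ?scale0r//= in_itv /= -/d memE => /andP[i1 i2].
move: ik; rewrite -val_eqE /= => /eqP; apply.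
case/andP: kP => k1 k2.
have ik1 : (i < k.+1)%N by rewrite -(ltr_nat R); exact: le_lt_trans k2.
have ki1 : (k < i.+1)%N by rewrite -(ltr_nat R); exact: le_lt_trans i2.
by apply/eqP; rewrite eqn_leq -ltnS ik1.
Qed.

(** The sampled functions converge to [Z] at continuity points, and dominated convergence makes the
    integrated error tend to 0. That error controls all pairings of the Riemann sums, which are
    therefore Cauchy in norm. *)
Lemma piecewise_bochner D a b Z M : a <= b ->
  (forall t, a < t < b -> t \notin D -> L2cvg Z (nbhs t) (Z t)) ->
  (forall t, a <= t <= b -> L2norm (Z t) <= M) ->
  exists2 I, bochner_integral a b Z I &
    forall h, inner I h = \int[leb]_(t in `[a, b]) inner (Z t) h.
Proof.
move=> ab cZ ZM; pose S := riemann_ts a b Z.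
have mab : measurable (`[a, b]%classic : set T) by exact: measurable_itv.
have M0 : 0 <= M by apply: le_trans (ZM a _); rewrite ?L2norm_ge0// lexx.
have cZh h t : a < t < b -> t \notin D -> {for t, continuous (fun s => inner (Z s) h)}.
  by move=> tab tD; apply: L2cvg_inner; exact: cZ.
have bZh h t : a <= t <= b -> `|inner (Z t) h| <= M * L2norm h.
  move=> tab; apply: (le_trans (normr_inner_le (Z t) h)).
  by rewrite ler_wpM2r ?L2norm_ge0// ZM.
have mZ h : measurable_fun `[a, b] (fun t : T => inner (Z t) h).
  exact: (piecewise_cont_measurable (cZh h)).
have mZZ : measurable_fun `[a, b] (fun t : T => inner (Z t) (Z t)).
  apply: (@piecewise_cont_measurable _ D) => t tab tD.
  have -> : (fun t : R => inner (Z t) (Z t)) = (fun t => L2norm (Z t) * L2norm (Z t)).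
    by apply/funext => s; rewrite -expr2 L2normE.
  by apply: cvgM; apply: L2cvg_norm; exact: cZ.
have good : {ae leb, forall t, `[a, b]%classic t -> a < t < b /\ t \notin D}.
  apply: ae_lebS (ae_notin_seq [:: a, b & D]) => t.
  rewrite !in_cons !negb_or => /and3P[ta tb tD] /=; rewrite in_itv /= => /andP[at_ bt].
  by split=> //; rewrite !lt_neqAle at_ bt tb eq_sym ta.
have approx : ts_approx a b Z S.
  apply: ae_lebS good => t H /H [tab tD]; apply/L2cvgP => e e0.
  have /L2cvgP /(_ e e0) /nbhs_ballP [d /= d0 Hd] := cZ t tab tD.
  case/andP: (tab) => at_ tb.
  have ba0 : 0 < b - a by rewrite subr_gt0 (lt_trans at_).
  have : \forall n \near \oo, (n.+1%:R^-1 : R) < d / (b - a).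
    have dba : 0 < d / (b - a) by rewrite divr_gt0.
    exact: near_infty_natSinv_lt (PosNum dba).
  apply: filterS => n nd.
  have [t' [at' t't tt' ->]] := @riemann_ts_val a b Z n t (ltW at_) tb.
  apply: Hd; rewrite /ball /= ger0_norm ?subr_ge0//.
  by apply: (le_lt_trans tt'); rewrite mulrC -ltr_pdivlMr.
have mdist n : measurable_fun `[a, b] (fun t : T => L2norm (Z t - ts_fun (S n) t)).
  exact: measurable_dist_ts_fun.
have idist n : leb.-integrable `[a, b] (EFin \o (fun t => L2norm (Z t - ts_fun (S n) t))).
  have [B HB] := ts_fun_bounded (S n).
  apply: measurable_bounded_integrable => //; [exact: itv_lty|exact: mdist|].
  exists (M + B); split; first exact: num_real.
  move=> x Bx t /=; rewrite in_itv /= => tab; apply: le_trans (ltW Bx).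
  rewrite ger0_norm ?L2norm_ge0//; apply: (le_trans (L2normD _ _)).
  by rewrite L2normN lerD ?ZM.
have cvg0 : (\int[leb]_(t in `[a, b]) (L2norm (Z t - ts_fun (S n) t))%:E)%E
    @[n --> \oo] --> 0%E.
  have [] := @dominated_convergence _ _ _ leb `[a, b]%classic (measurable_itv _)
    (fun n t => (L2norm (Z t - ts_fun (S n) t))%:E) (cst 0%E) (cst (M + M)%:E).
  - by move=> n; apply/measurable_EFinP; exact: mdist.
  - exact: measurable_cst.
  - apply: ae_lebS approx => t H /H ct /=.
    apply: cvg_EFin; first exact: nearW.
    apply/cvgrPdist_le => /= e e0; move/L2cvgP : ct => /(_ e e0).
    apply: filterS => n; rewrite sub0r normrN ger0_norm ?L2norm_ge0//.
    by rewrite L2distC.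
  - by apply: (@piecewise_integrable _ [::] _ _ (cst (M + M)) `|M + M|) => // t _ _;
      exact: cst_continuous.
  - apply: ae_lebS good => t H n /H [tab _] /=.
    case/andP: (tab) => at_ tb.
    rewrite lee_fin ger0_norm ?L2norm_ge0//; apply: (le_trans (L2normD _ _)).
    rewrite L2normN; apply: lerD; first by rewrite ZM// !ltW.
    have [t' [at' t't _ ->]] := @riemann_ts_val a b Z n t (ltW at_) tb.
    by rewrite ZM// at' (le_trans t't)// ltW.
  by move=> _ _; rewrite integral0.
pose e n := \int[leb]_(t in `[a, b]) L2norm (Z t - ts_fun (S n) t).
have e_cvg : e n @[n --> \oo] --> (0 : R).
  exact: fine_cvg.
(* The error is uniform in [h] up to its norm, which is what lets weak estimates give strong
   convergence. *)
have key n h : `|inner (ts_integral a b (S n)) h - \int[leb]_(t in `[a, b]) inner (Z t) h|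
    <= e n * L2norm h.
  have iZ : leb.-integrable `[a, b] (EFin \o (fun t => inner (Z t) h)).
    by apply: (@piecewise_integrable _ D _ _ _ (M * L2norm h)) => // t; [exact: cZh|exact: bZh].
  have iS : leb.-integrable `[a, b] (EFin \o (fun t => inner (ts_fun (S n) t) h)).
    exact: integrable_ts_fun.
  have iB : leb.-integrable `[a, b]
      (EFin \o (fun t => inner (ts_fun (S n) t) h - inner (Z t) h)).
    exact: (integrableB mab iS iZ).
  rewrite inner_ts_integral -RintegralB//.
  apply: (le_trans (le_normr_Rintegral _ iB)) => //.
  rewrite /e -RintegralZr//.
  apply: le_Rintegral => //.
  - exact: (integrable_norm iB).
  - exact: (integrableZr mab (L2norm h) (idist n)).
  - move=> t _; rewrite -innerBl L2distC; exact: normr_inner_le.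
have e_ge0 n : 0 <= e n by apply: Rintegral_ge0 => t _; exact: L2norm_ge0.
have [I cI] : exists I, L2cvg (fun n => ts_integral a b (S n)) \oo I.
  apply: L2_complete => r r0.
  have r20 : 0 < r / 2 by rewrite divr_gt0.
  move/cvgrPdist_le : (e_cvg) => /(_ _ r20) [n0 _ Hn0].
  exists n0 => m n mn0 nn0.
  have := Hn0 m mn0; have := Hn0 n nn0; rewrite /= !sub0r !normrN !ger0_norm// => en em.
  apply: L2norm_le_inner; first exact: ltW.
  (* Taking the difference of two Riemann sums as test function turns [key] into a norm estimate. *)
  set f := _ - _; rewrite {1}/f innerBl.
  have := key m f; have := key n f; rewrite !ler_norml => /andP[k1 k2] /andP[k3 k4].
  have := L2norm_ge0 f; nra.
exists I; first by exists S.
move=> h; apply/eqP; rewrite -subr_eq0 -normr_le0.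
apply/ler_addgt0Pl => r r0; rewrite addr0.
have cIh : inner (ts_integral a b (S n)) h @[n --> \oo] --> inner I h by exact: L2cvg_inner.
have ceh : e n * L2norm h @[n --> \oo] --> 0 * L2norm h by apply: cvgM => //; exact: cvg_cst.
have r20 : 0 < r / 2 by rewrite divr_gt0.
rewrite mul0r in ceh.
move/cvgrPdist_le : cIh => /(_ _ r20) [n0 _ Hn0].
move/cvgrPdist_le : ceh => /(_ _ r20) [n1 _ Hn1].
have := Hn0 _ (leq_maxl n0 n1); have := Hn1 _ (leq_maxr n0 n1) => /=.
rewrite sub0r normrN ger0_norm ?mulr_ge0 ?L2norm_ge0//.
have := key (maxn n0 n1) h.
set x := inner (ts_integral _ _ _) h; set y := \int[_]_(t in _) _.
move=> k1 k2 k3; rewrite -[_ - y](subrKA x) (splitr r).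
apply: (le_trans (ler_normD _ _)); apply: lerD; first exact: k3.
exact: (le_trans k1 k2).
Qed.

End Bochner.

(** * The cone K and the spaces H_X *)

Section OmegaAE.
Variable R : realType.
Local Notation mu := (leb_Omega R).
Local Notation leb := (@lebesgue_measure R).
Local Notation T := (measurableTypeR R).

Lemma leb_OmegaE (A : set T) : mu A = leb (A `&` Omega R).
Proof. by []. Qed.

Lemma measurable_Omega : measurable (Omega R : set T).
Proof. exact: measurable_itv. Qed.

(* Instance resolution finds the library instance only for the bundled measure. *)
#[global] Instance ae_Omega_filter : Filter (almost_everywhere mu).
Proof. exact: (@ae_filter_ringOfSetsType _ T R (leb_Omega R)). Qed.

(** The complement of Omega is null for the restricted measure and can be added to the exceptional
    set. *)
Lemma ae_OmegaS (P Q : R -> Prop) : (forall m, Omega R m -> P m -> Q m) ->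
  {ae mu, forall m, P m} -> {ae mu, forall m, Q m}.
Proof.
move=> PQ [A [mA A0 sA]]; exists (A `|` ~` Omega R); split.
- by apply: measurableU => //; apply: measurableC; exact: measurable_Omega.
- rewrite leb_OmegaE setIUl setICl setU0; exact: A0.
- move=> m /= nQ; have [Om|] := pselect (Omega R m); last by right.
  by left; apply: sA => Pm; apply: nQ; exact: PQ.
Qed.

Lemma ae_Omega (P : R -> Prop) : (forall m, Omega R m -> P m) ->
  {ae mu, forall m, P m}.
Proof.
move=> H; apply: (@ae_OmegaS (fun=> True)) => [m Om _|]; first exact: H.
by exists set0; split => // m /= [].
Qed.

Lemma ae_OmegaI (P Q : R -> Prop) : {ae mu, forall m, P m} ->
  {ae mu, forall m, Q m} -> {ae mu, forall m, P m /\ Q m}.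
Proof. by move=> aP aQ; apply: filterS2 aP aQ => m. Qed.

Lemma ae_Omega_notin_seq (D : seq R) : {ae mu, forall m, m \notin D}.
Proof.
exists [set` D]; split; first exact: measurable_seq.
  apply/eqP; rewrite eq_le measure_ge0 andbT.
  rewrite -(@countable_lebesgue_measure0 R [set` D]); last first.
    exact: finite_set_countable.
  rewrite leb_OmegaE; apply: le_measure; rewrite ?inE.
  - by apply: measurableI; [exact: measurable_seq|exact: measurable_Omega].
  - exact: measurable_seq.
  - exact: subIsetl.
by move=> t /= /negP; rewrite negbK.
Qed.

(** A nonempty open interval inside Omega has positive measure, so it does not fit in an exceptional
    set. *)
Lemma ae_Omega_exists (a b : R) (P : R -> Prop) : a < b ->
  `]a, b[%classic `<=` Omega R ->
  {ae mu, forall m, `]a, b[%classic m -> P m} -> exists2 m, a < m < b & P m.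
Proof.
move=> ab sub [A [mA A0 sA]]; apply: contrapT => nex.
have sabA : `]a, b[%classic `<=` A.
  move=> m abm; apply: sA => /= /(_ abm) Pm; by apply: nex; exists m.
have : (leb `]a, b[%classic <= 0)%E.
  rewrite -A0 leb_OmegaE; apply: le_measure; rewrite ?inE //.
  - by apply: measurableI => //; exact: measurable_Omega.
  - by move=> m abm; split; [exact: sabA|exact: sub].
by rewrite lebesgue_measure_itv /= lte_fin ab -EFinB lee_fin subr_le0 leNgt ab.
Qed.

End OmegaAE.

(** * Local constancy, right-continuous representatives and inclusions between the spaces
    [H_of X] *)

Section Cone.
Variable R : realType.
Implicit Types (f g h X Y U W P Q A : L2 R) (a b c m y : R) (s : seq R).
Local Notation mu := (leb_Omega R).
Local Notation T := (measurableTypeR R).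

Lemma L2_sumE (I : Type) (r : seq I) (F : I -> L2 R) (p : pred I) m :
  (\sum_(i <- r | p i) F i) m = \sum_(i <- r | p i) F i m.
Proof. by apply: (big_morph (fun f : L2 R => f m)). Qed.

Lemma KconeD X Y : Kcone R X -> Kcone R Y -> Kcone R (X + Y).
Proof.
move=> [X1 X2] [Y1 Y2]; split=> [m1 m2 O1 O2 m12|m Om].
  by apply: lerD; [exact: X1|exact: Y1].
by apply: cvgD; [exact: X2|exact: Y2].
Qed.

Lemma Omega_ofP X m : Omega_of X m <->
  exists2 e, 0 < e & forall m', `|m - m'| < e -> Omega R m' /\ X m' = X m.
Proof.
split=> [[Om /nbhs_ballP [e /= e0 He]]|[e e0 H]].
  have oO : nbhs m (Omega R).
    by apply: open_nbhs_nbhs; split => //; exact: interval_open.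
  move/nbhs_ballP : oO => [d /= d0 Hd].
  exists (Num.min d e); first by rewrite lt_min d0.
  by move=> m'; rewrite lt_min => /andP[md me]; split; [exact: Hd|exact: He].
split; first by apply: (H m _).1; rewrite subrr normr0.
by apply/nbhs_ballP; exists e => //= m' /H [].
Qed.

(** Local constancy gives a zero derivative throughout the interval, and the mean value theorem
    makes the function constant. *)
Lemma Omega_of_const X a b : `]a, b[%classic `<=` Omega_of X ->
  forall m1 m2, a < m1 < b -> a < m2 < b -> X m1 = X m2.
Proof.
move=> sub.
have der m : a < m < b -> is_derive m 1 (X : R -> R) 0.
  move=> mab; have [_ Xm] : Omega_of X m by apply: sub; rewrite /= in_itv.
  have e : \forall x \near m, cst (X m) x = X x by apply: filterS Xm => x ->.
  exact: (near_eq_is_derive e (is_derive_cst _ _ _)).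
suff H m1 m2 : a < m1 < b -> a < m2 < b -> m1 <= m2 -> X m1 = X m2.
  move=> m1 m2 h1 h2; case: (lerP m1 m2) => h; first exact: H.
  by apply/esym/H => //; exact: ltW.
move=> /andP[am1 m1b] /andP[am2 m2b] m12.
have cX : {within `[m1, m2], continuous (X : R -> R)}.
  apply: derivable_within_continuous => x; rewrite in_itv /= => /andP[h1 h2].
  have xab : a < x < b by rewrite (lt_le_trans am1 h1) (le_lt_trans h2 m2b).
  by case: (der x xab).
have [x|c _] := @MVT_segment R X (fun=> 0) m1 m2 m12 _ cX.
  rewrite in_itv /= => /andP[h1 h2]; apply: der.
  by rewrite (lt_trans am1 h1) (lt_trans h2 m2b).
by rewrite mul0r => /eqP; rewrite subr_eq0 => /eqP ->.
Qed.

Lemma H_of_self X : H_of X X.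
Proof.
move=> a b sub; exists (X ((a + b) / 2)); apply: ae_Omega => m _ /=.
rewrite in_itv /= => mab; apply: (Omega_of_const sub) => //.
by move: mab => /andP[am mb]; rewrite ltr_pdivrMr// ltr_pdivlMr//; lra.
Qed.

Lemma H_ofD X U W : H_of X U -> H_of X W -> H_of X (U + W).
Proof.
move=> HU HW a b sub; have [c Uc] := HU a b sub; have [d Wd] := HW a b sub.
exists (c + d); apply: filterS2 Uc Wd => m Uc Wd mab.
have -> : (U + W) m = U m + W m by [].
by rewrite Uc// Wd.
Qed.

Lemma H_ofZ X c U : H_of X U -> H_of X (c *: U).
Proof.
move=> HU a b sub; have [d Ud] := HU a b sub.
exists (c * d); apply: filterS Ud => m Ud mab.
have -> : (c *: U) m = c * U m by [].
by rewrite Ud.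
Qed.

Lemma H_of0 X : H_of X 0.
Proof. by rewrite -(scale0r X); apply: H_ofZ; exact: H_of_self. Qed.

Lemma H_of_sum X (I : Type) (r : seq I) (F : I -> L2 R) :
  (forall i, H_of X (F i)) -> H_of X (\sum_(i <- r) F i).
Proof. by move=> HF; apply: big_ind => //; [exact: H_of0|exact: H_ofD]. Qed.

Lemma H_of_ae X U W : {ae mu, forall m, U m = W m} -> H_of X U -> H_of X W.
Proof.
move=> UW HU a b sub; have [c Uc] := HU a b sub; exists c.
by apply: filterS2 UW Uc => m <-.
Qed.

(** By right continuity, a value outside the finite set [s] would keep [X] outside [s] on an
    interval to the right, which has positive measure. *)
Lemma Kcone_ae_mem X a b s : Kcone R X -> `]a, b[%classic `<=` Omega R ->
  {ae mu, forall m, `]a, b[%classic m -> X m \in s} ->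
  forall m, a < m < b -> X m \in s.
Proof.
move=> [_ rX] sub Xs m /andP[am mb]; apply/negPn/negP => Xms.
have Om : Omega R m by apply: sub; rewrite /= in_itv /= am.
have : nbhs (X m) (~` [set` s]).
  apply: open_nbhs_nbhs; split; last by move=> /=; exact/negP.
  by apply: closed_openC; exact: closed_seq.
move/(rX m Om); rewrite /= /at_right /nbhs /= /within /=.
move=> /nbhs_ballP [e /= e0 He].
have [m' /andP[mm' m'b] [_ Xm's]] : exists2 m', m < m' < Num.min b (m + e) &
    (m < m' < Num.min b (m + e)) /\ X m' \in s.
  apply: ae_Omega_exists.
  - by rewrite lt_min mb ltrDl.
  - move=> x /=; rewrite in_itv /= lt_min => /and3P[mx xb _]; apply: sub => /=.
    by rewrite in_itv /= xb (lt_trans am).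
  - apply: filterS Xs => x H /=; rewrite in_itv /= => mx; split=> //.
    apply: H; rewrite /= in_itv /=; move: mx; rewrite lt_min => /and3P[mx xb _].
    by rewrite xb (lt_trans am).
move: m'b; rewrite lt_min => /andP[_ m'e].
apply: (He m') => //=; rewrite /ball /= ltr_distlC; apply/andP; split; last by [].
by rewrite (lt_trans _ mm')// ltrBlDr ltrDl.
Qed.

Lemma Kcone_ae_mem_Omega X s : Kcone R X ->
  {ae mu, forall m, X m \in s} -> forall m, Omega R m -> X m \in s.
Proof.
move=> KX Xs m; rewrite /Omega /= in_itv /= => Om.
apply: (Kcone_ae_mem KX _ _ Om); first by [].
by apply: filterS Xs => x ? _.
Qed.

(** Membership in [H_of Y] gives constancy almost everywhere near each point; right continuity makes
    it pointwise. This is the source of stickiness. *)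
Lemma Omega_of_mono X Y : Kcone R X -> H_of Y X -> Omega_of Y `<=` Omega_of X.
Proof.
move=> KX HX m /Omega_ofP [e e0 H].
have near_sub m' : m - e < m' < m + e -> `|m - m'| < e.
  by move=> /andP[h1 h2]; rewrite ltr_distlC h1.
have sub : `]m - e, m + e[%classic `<=` Omega_of Y.
  move=> x /=; rewrite in_itv /= => xme; apply/Omega_ofP.
  move: (xme) => /andP[h1 h2].
  exists (Num.min (x - (m - e)) (m + e - x)); first by rewrite lt_min !subr_gt0 h1.
  move=> m'; rewrite lt_min => /andP[d1 d2].
  have m'm : m - e < m' < m + e.
    by move: d1 d2; rewrite !ltr_distlC => /andP[? ?] /andP[? ?]; apply/andP; split; lra.
  have [Om' ->] := H m' (near_sub m' m'm).
  by have [_ ->] := H x (near_sub x xme).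
have [c Xc] := HX _ _ sub.
have subO : `]m - e, m + e[%classic `<=` Omega R.
  by move=> x /sub [].
have Xc' x : m - e < x < m + e -> X x = c.
  move=> xme; have := @Kcone_ae_mem X (m - e) (m + e) [:: c] KX subO _ x xme.
  rewrite inE => /(_ _)/eqP; apply.
  by apply: filterS Xc => z Hz zme; rewrite inE Hz.
apply/Omega_ofP; exists e => // m' m'e.
have m'i : m - e < m' < m + e by move: m'e; rewrite ltr_distlC.
split; first by apply: subO; rewrite /= in_itv.
by rewrite !Xc'// ltrBlDr !ltrDl e0.
Qed.

Lemma H_of_mono X Y : Kcone R X -> H_of Y X -> H_of X `<=` H_of Y.
Proof. by move=> KX HX U HU a b sub; apply: HU => m /sub; exact: Omega_of_mono. Qed.

End Cone.

(** * Projection on H_X by averaging over level sets *)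

Section Projection.
Variable R : realType.
Implicit Types (f g h U Y P Q : L2 R) (C : set (L2 R)).

Lemma inner_eq0 f g : inner g g = 0 -> inner f g = 0.
Proof. by move=> g0; rewrite innerC inner_eq0l// L2norm_sqrt g0 sqrtr0. Qed.

Definition subspace C := [/\ C 0, (forall f g, C f -> C g -> C (f + g)) &
  (forall (c : R) f, C f -> C (c *: f))].

Lemma H_of_subspace (X : L2 R) : subspace (H_of X).
Proof. by split; [exact: H_of0|exact: H_ofD|exact: H_ofZ]. Qed.

(** Minimality of the distance along the line [P + t *: U] gives a quadratic in [t] that is
    nonnegative and vanishes at 0. *)
Lemma is_proj_orth C Y P U : subspace C -> is_proj C Y P -> C U ->
  inner (Y - P) U = 0.
Proof.
move=> [_ CD CZ] [CP H] CU.
have E (t : R) : 0 <= - (2 * t * inner (Y - P) U) + t ^+ 2 * inner U U.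
  have := H (P + t *: U) (CD _ _ CP (CZ t _ CU)).
  rewrite -ler_sqr ?nnegrE ?L2norm_ge0// !L2normE.
  rewrite opprD addrA [X in _ <= X -> _]innerBl !innerBr !innerE (innerC U Y) (innerC U P).
  by lra.
have [u0|un0] := eqVneq (inner U U) 0.
  by apply: inner_eq0 u0.
apply/eqP; apply/negPn/negP => n0.
have up : 0 < inner U U by rewrite lt_neqAle eq_sym un0 inner_ge0.
(* This is the minimizer of the quadratic, whose minimum is negative unless the pairing is zero. *)
have := E (inner (Y - P) U / inner U U).
set i := inner (Y - P) U.
have -> : - (2 * (i / inner U U) * i) + (i / inner U U) ^+ 2 * inner U U =
   - (i ^+ 2 / inner U U) by field.
rewrite oppr_ge0 leNgt divr_gt0// exprn_even_gt0//=.
Qed.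

(** By orthogonality of both residuals, [P1 - P2] paired with itself equals [Y1 - Y2] paired with
    [P1 - P2]. *)
Lemma is_proj_dist C Y1 Y2 P1 P2 : subspace C ->
  is_proj C Y1 P1 -> is_proj C Y2 P2 -> L2norm (P1 - P2) <= L2norm (Y1 - Y2).
Proof.
move=> sC H1 H2; have [_ CD CZ] := sC; case: (H1) => C1 _; case: (H2) => C2 _.
have CU : C (P1 - P2) by rewrite -scaleN1r; apply: CD => //; exact: CZ.
have o1 := is_proj_orth sC H1 CU; have o2 := is_proj_orth sC H2 CU.
apply: L2norm_le_inner; first exact: L2norm_ge0.
apply: le_trans (inner_le _ _).
move: o1 o2; rewrite !innerBl; lra.
Qed.

Lemma is_proj_norm C Y P : subspace C -> is_proj C Y P -> L2norm P <= L2norm Y.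
Proof.
move=> sC H; have [C0 _ _] := sC.
have H0 : is_proj C 0 0 by split=> // Q _; rewrite subrr L2norm0 L2norm_ge0.
by have := is_proj_dist sC H H0; rewrite !subr0.
Qed.

Lemma is_proj_unique C Y P Q : subspace C -> is_proj C Y P -> C Q ->
  (forall U, C U -> inner (Y - Q) U = 0) -> L2eq P Q.
Proof.
move=> sC H CQ HQ; have [_ CD CZ] := sC; case: (H) => CP _.
have CU : C (P - Q) by rewrite -scaleN1r; apply: CD => //; exact: CZ.
rewrite /L2eq; apply/eqP; rewrite eq_le L2norm_ge0 andbT.
apply: L2norm_le_inner => //; rewrite mul0r.
have := is_proj_orth sC H CU; have := HQ _ CU.
by rewrite !innerBl; lra.
Qed.

Lemma is_proj_of_inner C Y P : C P ->
  (forall Q, C Q -> inner (Y - P) (Q - P) <= 0) -> is_proj C Y P.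
Proof.
move=> CP H; split=> // Q CQ.
rewrite -ler_sqr ?nnegrE ?L2norm_ge0// !L2normE.
have := inner_ge0 (Q - P); have := H Q CQ.
by rewrite !innerE (innerC P Y) (innerC Q Y) (innerC Q P); lra.
Qed.

End Projection.

(** * Indicators and averages of level sets; Chebyshev's inequality *)

Section LevelSets.
Variable R : realType.
Implicit Types (f g h X Y U W P Q A : L2 R) (a b c m y : R) (s : seq R).
Local Notation mu := (leb_Omega R).
Local Notation T := (measurableTypeR R).

Definition level X y : set T := [set m | Omega R m /\ X m = y].

Lemma measurable_level X y : measurable (level X y).
Proof.
have -> : level X y = Omega R `&` (setT `&` X @^-1` [set y]).
  by apply/seteqP; split=> [m [? ?]|m [? [_ ?]]].
apply: measurableI; first exact: measurable_Omega.
exact: (L2_measurable X measurableT (measurable_set1 y)).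
Qed.

Definition level_ind X y : L2 R :=
  Lfun_Sub (lee1n 2) (indic_Lfun (measurable_level X y)).

Lemma level_indE X y m : level_ind X y m = \1_(level X y) m.
Proof. by []. Qed.

Opaque level_ind.

Lemma level_ind_in X m : Omega R m -> level_ind X (X m) m = 1.
Proof. by move=> Om; rewrite level_indE indicE mem_set. Qed.

Lemma level_ind_out X y m : X m != y -> level_ind X y m = 0.
Proof. by move=> /eqP Xy; rewrite level_indE indicE memNset// => -[]. Qed.

Lemma H_of_level_ind X y : H_of X (level_ind X y).
Proof.
move=> a b sub; exists (level_ind X y ((a + b) / 2)); apply: ae_Omega => m _ mab0.
have mab : a < m < b by move: mab0; rewrite /= in_itv.
have cab : a < (a + b) / 2 < b.
  by move: mab => /andP[am mb]; rewrite ltr_pdivrMr// ltr_pdivlMr//; lra.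
have O x : a < x < b -> Omega R x.
  by move=> xab; have [] : Omega_of X x by apply: sub; rewrite /= in_itv.
have e := Omega_of_const sub mab cab.
have [Xy|Xy] := eqVneq (X m) y.
  have -> : level_ind X y m = 1 by rewrite -Xy (level_ind_in _ (O _ mab)).
  by rewrite -Xy e (level_ind_in _ (O _ cab)).
by rewrite !level_ind_out -?e.
Qed.

(* Level sets of a nondecreasing function are intervals up to their end points. *)
Lemma H_of_level_ae X U y : Kcone R X -> H_of X U ->
  exists c, {ae mu, forall m, level X y m -> U m = c}.
Proof.
move=> [mX _] HU; pose C := level X y.
have [[x0 Cx0]|nC] := pselect (C !=set0); last first.
  by exists 0; apply: ae_Omega => m _ Cm; exfalso; apply: nC; exists m.
have sC m : C m -> 0 < m < 1 by case=> /=; rewrite /Omega /= in_itv.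
have hi : has_inf C by split; [exists x0|exists 0 => m /sC /andP[/ltW]].
have hs : has_sup C by split; [exists x0|exists 1 => m /sC /andP[_ /ltW]].
have subC : `]inf C, sup C[%classic `<=` C.
  move=> m /=; rewrite in_itv /= => /andP[am mb].
  have [m1 C1 m1m] := inf_lt hi.1 am.
  have [m2 C2 mm2] := sup_gt hs.1 mb.
  have [/andP[p1 _] /andP[_ p2]] := (sC _ C1, sC _ C2).
  have Om : Omega R m.
    by rewrite /Omega /= in_itv /= (lt_trans p1 m1m) (lt_trans mm2 p2).
  split => //; case: C1 => O1 X1; case: C2 => O2 X2.
  have := mX _ _ O1 Om (ltW m1m); have := mX _ _ Om O2 (ltW mm2).
  by rewrite X1 X2 => h1 h2; apply/eqP; rewrite eq_le h1.
have subO : `]inf C, sup C[%classic `<=` Omega_of X.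
  move=> m mC; have [Om Xm] := subC m mC; split=> //.
  have : nbhs m `]inf C, sup C[%classic.
    by apply: open_nbhs_nbhs; split=> //; exact: interval_open.
  by apply: filterS => m' /subC [_ ->].
have [c Uc] := HU _ _ subO; exists c.
apply: filterS2 Uc (ae_Omega_notin_seq [:: inf C; sup C]) => m Uc.
rewrite !inE negb_or => /andP[mi ms] Cm; apply: Uc; rewrite /= in_itv /=.
rewrite !lt_neqAle eq_sym mi ms /=; apply/andP; split.
  by apply: ge_inf => //; case: hi.
by apply: sup_upper_bound.
Qed.

(** The list may contain numbers that [X] does not take; [uniq] ensures that a sum over it counts
    each level once. *)
Definition has_values X s := uniq s /\ forall m, Omega R m -> X m \in s.

Lemma level_sum_at X s (c : R -> R) m : has_values X s -> Omega R m ->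
  (\sum_(y <- s) c y *: level_ind X y) m = c (X m).
Proof.
move=> [us vX] Om; rewrite L2_sumE.
transitivity (\sum_(y <- s) c y * level_ind X y m); first by [].
rewrite (bigD1_seq (X m)) ?vX//= level_ind_in// mulr1 big1 ?addr0// => y yX.
by rewrite level_ind_out ?mulr0 // eq_sym.
Qed.

(** The constants found on the levels define [c]; the induction on [s] unites finitely many null
    sets. *)
Lemma H_of_level_sum X s U : Kcone R X -> has_values X s -> H_of X U ->
  exists c : R -> R, {ae mu, forall m, U m = c (X m)}.
Proof.
move=> KX [_ vX] HU.
have /choice[c Hc] := fun y => H_of_level_ae y KX HU.
exists c.
have : {ae mu, forall m, forall y, y \in s -> level X y m -> U m = c y}.
  elim: s {vX} => [|y s IH]; first by apply: ae_Omega.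
  apply: filterS2 (Hc y) IH => m h1 h2 z; rewrite inE => /predU1P[->|] //; exact: h2.
by apply: ae_OmegaS => m Om H; apply: (H (X m)) => //; exact: vX.
Qed.

Lemma inner_level_ind X y z : y != z ->
  inner (level_ind X y) (level_ind X z) = 0.
Proof.
move=> yz; rewrite -(inner0l (0 : L2 R)); apply: ae_inner; apply: ae_Omega => m Om.
have -> : (0 : L2 R) m = 0 by [].
rewrite mul0r; have [Xy|Xy] := eqVneq (X m) y.
  by rewrite (@level_ind_out _ z) ?mulr0// Xy.
by rewrite level_ind_out// mul0r.
Qed.

(** The denominator is the measure of the level set. On a null level it is 0 and the quotient takes
    the value 0. *)
Definition level_avg X f y : R :=
  inner f (level_ind X y) / inner (level_ind X y) (level_ind X y).

Definition level_proj X s f : L2 R := \sum_(y <- s) level_avg X f y *: level_ind X y.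

Lemma level_proj_at X s f m : has_values X s -> Omega R m ->
  level_proj X s f m = level_avg X f (X m).
Proof. exact: level_sum_at. Qed.

Lemma H_of_level_proj X s f : H_of X (level_proj X s f).
Proof.
by apply: H_of_sum => y; apply: H_ofZ; exact: H_of_level_ind.
Qed.

Lemma level_proj_orth_ind X s f y : uniq s -> y \in s ->
  inner (f - level_proj X s f) (level_ind X y) = 0.
Proof.
move=> us ys; rewrite innerBl inner_suml (bigD1_seq y)//= innerZl big1 ?addr0.
  (* The indicator of a null level has norm zero, so its pairing with [f] vanishes and agrees with
     the default average. *)
  rewrite /level_avg; have [e|n0] := eqVneq (inner (level_ind X y) (level_ind X y)) 0.
    by rewrite e mulr0 subr0 (inner_eq0 _ e).
  by rewrite divfK// subrr.
by move=> z zy; rewrite innerZl inner_level_ind ?mulr0.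
Qed.

Lemma level_proj_orth X s f U : Kcone R X -> has_values X s -> H_of X U ->
  inner (f - level_proj X s f) U = 0.
Proof.
move=> KX vX HU; have [c Uc] := H_of_level_sum KX vX HU.
have e : L2eq U (\sum_(y <- s) c y *: level_ind X y).
  by apply: ae_L2eq; apply: ae_OmegaS Uc => m Om ->; rewrite level_sum_at.
rewrite innerC (L2eq_innerl _ e) inner_suml big1_seq// => y /= ys.
by rewrite innerZl innerC level_proj_orth_ind ?mulr0//; case: vX.
Qed.

(** Almost everywhere [X] is a function of [X0]; right continuity extends the finite list of values
    to all of Omega. This propagates finiteness from time 0. *)
Lemma has_values_H_of X0 X s0 : Kcone R X0 -> Kcone R X -> has_values X0 s0 ->
  H_of X0 X -> exists s, has_values X s.
Proof.
move=> KX0 KX v0 HX; have [c Xc] := H_of_level_sum KX0 v0 HX.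
exists (undup (map c s0)); split; first exact: undup_uniq.
move=> m; apply: Kcone_ae_mem_Omega => //.
apply: ae_OmegaS Xc => x Ox ->; rewrite mem_undup map_f//.
by case: v0 => _; apply.
Qed.

Lemma has_values_bounded X s : has_values X s ->
  exists B : R, forall m, Omega R m -> `|X m| <= B.
Proof.
move=> [us vX]; exists (\sum_(y <- s) `|y|) => m Om.
by rewrite (bigD1_seq (X m)) ?vX//= lerDl sumr_ge0.
Qed.

(* On a level set, the mean-zero function [Y - level_proj X s Y] changes sign at
   most once; [d] is a value of [A] at the sign change. *)
Lemma Chebyshev_level X s A Y (B : R) : Kcone R X -> has_values X s ->
  Kcone R A -> Kcone R Y -> (forall m, Omega R m -> `|A m| <= B) ->
  0 <= inner A (Y - level_proj X s Y).
Proof.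
move=> KX vX [mA _] [mY _] AB.
pose q := level_avg X Y.
(* The lower bound [- B] of [A] is added so that the supremum is taken over a nonempty set even if
   no point of the level lies below the average. *)
pose low y : set R := [set r | r = - B \/
  exists m, [/\ Omega R m, X m = y, Y m < q y & r = A m]].
pose d y := sup (low y).
pose D : L2 R := \sum_(y <- s) d y *: level_ind X y.
have HD : H_of X D by apply: H_of_sum => y; apply: H_ofZ; exact: H_of_level_ind.
have -> : inner A (Y - level_proj X s Y) = inner (A - D) (Y - level_proj X s Y).
  by rewrite innerBl [inner D _]innerC level_proj_orth// subr0.
apply: ae_inner_ge0; apply: ae_Omega => m Om.
have -> : (A - D) m = A m - D m by [].
have -> : (Y - level_proj X s Y) m = Y m - level_proj X s Y m by [].
rewrite level_proj_at// level_sum_at// -/q.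
have [Yq|Yq] := ltP (Y m) (q (X m)).
  apply: mulr_le0; last by rewrite subr_le0 ltW.
  rewrite subr_le0; apply: ub_le_sup; last by right; exists m.
  exists `|B| => r [->|[m' [Om' _ _ ->]]]; first by rewrite -normrN ler_norm.
  by apply: (le_trans (ler_norm _)); apply: (le_trans (AB m' Om')); exact: ler_norm.
apply: mulr_ge0; last by rewrite subr_ge0.
rewrite subr_ge0; apply: ge_sup; first by exists (- B); left.
move=> r [->|[m' [Om' Xm' Yq' ->]]].
  by have := AB m Om; rewrite ler_norml => /andP[].
apply: mA => //; rewrite leNgt; apply/negP => mm'.
by have := mY _ _ Om Om' (ltW mm'); rewrite leNgt (lt_le_trans Yq' Yq).
Qed.

End LevelSets.

(** * Jensen's inequality *)

Section Jensen.
Variable R : realType.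
Implicit Types (f g X P : L2 R) (s : seq R).
Local Notation mu := (leb_Omega R).
Local Notation T := (measurableTypeR R).

(** The slope is the supremum of the chord slopes to the left of [q]. Finite values on both sides of
    [q] make that set nonempty and bounded above by a right chord slope. *)
Lemma subgradient (psi : R -> \bar R) (q y1 y2 : R) :
  (forall x, 0 <= psi x)%E -> convex_ereal psi ->
  y1 < q -> q < y2 -> (psi y1 < +oo)%E -> (psi y2 < +oo)%E ->
  exists p : R, forall z, (psi q + (p * (z - q))%:E <= psi z)%E.
Proof.
move=> psi0 cpsi y1q qy2 psi1 psi2.
have fin y : (psi y < +oo)%E -> (fine (psi y))%:E = psi y.
  by move=> yo; rewrite fineK// ge0_fin_numE.
have cvx y z : y < q -> q < z -> (psi y < +oo)%E -> (psi z < +oo)%E ->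
    (psi q <= ((z - q) / (z - y) * fine (psi y) + (q - y) / (z - y) * fine (psi z))%:E)%E.
  move=> yq qz yo zo.
  have zy0 : 0 < z - y by rewrite subr_gt0 (lt_trans yq).
  have zyN : z - y != 0 by rewrite gt_eqF.
  have t01 : 0 <= (z - q) / (z - y) <= 1.
    apply/andP; split; first by apply: divr_ge0; lra.
    by rewrite ler_pdivrMr// mul1r; lra.
  have := cpsi y z _ t01.
  have -> : (z - q) / (z - y) * y + (1 - (z - q) / (z - y)) * z = q by field.
  have -> : 1 - (z - q) / (z - y) = (q - y) / (z - y) by field.
  by rewrite -(fin y yo) -(fin z zo) -!EFinM -EFinD.
have qo : (psi q < +oo)%E by apply: le_lt_trans (cvx _ _ y1q qy2 psi1 psi2) _; rewrite ltry.
pose phi y := fine (psi y).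
have chord y z : y < q -> q < z -> (psi y < +oo)%E -> (psi z < +oo)%E ->
    (phi q - phi y) / (q - y) <= (phi z - phi q) / (z - q).
  move=> yq qz yo zo; have := cvx y z yq qz yo zo.
  rewrite -(fin q qo) lee_fin -/(phi y) -/(phi z) -/(phi q).
  have zy0 : 0 < z - y by rewrite subr_gt0 (lt_trans yq).
  have -> : (z - q) / (z - y) * phi y + (q - y) / (z - y) * phi z =
    ((z - q) * phi y + (q - y) * phi z) / (z - y) by field; rewrite gt_eqF.
  rewrite ler_pdivlMr// => H.
  rewrite ler_pdivrMr ?subr_gt0// mulrAC ler_pdivlMr ?subr_gt0//.
  by lra.
pose S := [set r | exists y, [/\ y < q, (psi y < +oo)%E & r = (phi q - phi y) / (q - y)]].
have S0 : S !=set0 by exists ((phi q - phi y1) / (q - y1)); exists y1.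
exists (sup S) => z.
have [->|zo] := eqVneq (psi z) +oo%E; first by rewrite leey.
have {}zo : (psi z < +oo)%E by rewrite lt_neqAle zo leey.
rewrite -(fin q qo) -(fin z zo) -EFinD lee_fin -/(phi q) -/(phi z).
have [zq|qz|->] := ltgtP z q; last by rewrite subrr mulr0 addr0.
- have : (phi q - phi z) / (q - z) <= sup S.
    apply: ub_le_sup; last by exists z.
    exists ((phi y2 - phi q) / (y2 - q)) => r [y [yq yo ->]]; exact: chord.
  by rewrite ler_pdivrMr ?subr_gt0//; lra.
- have : sup S <= (phi z - phi q) / (z - q).
    by apply: ge_sup => // r [y [yq yo ->]]; exact: chord.
  by rewrite ler_pdivlMr ?subr_gt0//; lra.
Qed.

Lemma inner_ae_eq0 f g : {ae mu, forall m, 0 <= f m * g m} -> inner f g = 0 ->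
  {ae mu, forall m, f m * g m = 0}.
Proof.
move=> fg0 fg.
have mfg : measurable_fun setT (fun m : T => (f m * g m)%:E).
  by apply/measurable_EFinP/measurable_funM; exact: L2_measurable.
have : (\int[mu]_m `|(f m * g m)%:E| = 0)%E.
  have e : (\int[mu]_m `|(f m * g m)%:E| = \int[mu]_m (f m * g m)%:E)%E.
    apply: ae_eq_integral => //; first exact: measurableT_comp.
    by apply: filterS fg0 => m h _; rewrite gee0_abs.
  rewrite e -(fineK (integrable_fin_num measurableT (inner_integrable f g))).
  by congr EFin; exact: fg.
move/(ae_eq_integral_abs _ measurableT mfg).
by apply: filterS => m /(_ I) [].
Qed.

(** On each level the tangent inequality of [psi] at the average is integrated, and its linear term
    has integral zero. If [psi] is infinite on one side of the average, there may be no tangent, but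
    then [f] equals its average on that level. *)
Lemma is_proj_convex_dominated X s f P : Kcone R X -> has_values X s ->
  is_proj (H_of X) f P -> convex_dominated P f.
Proof.
move=> KX vX projP psi psi0 cpsi lpsi.
pose q := level_avg X f.
have Pq : {ae mu, forall m, P m = q (X m)}.
  have /L2eq_ae := is_proj_unique (H_of_subspace X) projP (@H_of_level_proj R X s f)
    (fun U => level_proj_orth f KX vX).
  by apply: ae_OmegaS => m Om ->; rewrite level_proj_at.
have mpsi g : measurable_fun setT (fun m : T => psi (g m)).
  apply: (measurableT_comp (f := psi)); last exact: L2_measurable.
  exact: lower_semicontinuous_measurable.
have [->|foo] := eqVneq (\int[mu]_m psi (f m))%E +oo%E; first by rewrite leey.
have fino : {ae mu, forall m, (psi (f m) < +oo)%E}.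
  have : mu.-integrable setT (fun m => psi (f m)).
    apply/integrableP; split; first exact: mpsi.
    under eq_integral do rewrite gee0_abs//.
    by rewrite lt_neqAle foo leey.
  move/(integrable_ae measurableT); apply: filterS => m /(_ I).
  by rewrite ge0_fin_numE.
(* The deviation from the average has mean zero on the level, so a constant sign forces it to
   vanish. *)
have fq y : y \in s -> {ae mu, forall m, 0 <= (f - level_proj X s f) m * level_ind X y m} ->
    {ae mu, forall m, level X y m -> f m = q y}.
  move=> ys h; have := inner_ae_eq0 h (level_proj_orth_ind X f vX.1 ys).
  apply: ae_OmegaS => m Om + [_ Xm].
  rewrite -Xm level_ind_in// mulr1.
  have -> : (f - level_proj X s f) m = f m - level_proj X s f m by [].
  by rewrite level_proj_at// => /eqP; rewrite subr_eq0 => /eqP.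
have tangent y : exists p : R, {ae mu, forall m, level X y m ->
    (psi (q y) + (p * (f m - q y))%:E <= psi (f m))%E}.
  have [ys|ys] := boolP (y \in s); last first.
    exists 0; apply: ae_Omega => m Om [_ Xm]; move: ys; rewrite -Xm.
    by case: (vX) => _ ->.
  have cstcase : {ae mu, forall m, level X y m -> f m = q y} ->
      exists p : R, {ae mu, forall m, level X y m ->
        (psi (q y) + (p * (f m - q y))%:E <= psi (f m))%E}.
    move=> h; exists 0; apply: filterS h => m h Xm.
    by rewrite h// mul0r adde0.
  have valE m : Omega R m -> X m = y ->
      (f - level_proj X s f) m * level_ind X y m = f m - q y.
    move=> Om Xm; rewrite -Xm level_ind_in// mulr1.
    have -> : (f - level_proj X s f) m = f m - level_proj X s f m by [].
    by rewrite level_proj_at.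
  (* Since [psi (f m)] is finite almost everywhere, infinite values of [psi] below [q y] force [f]
     to stay at or above its average. *)
  have [[y1 [y1q y1o]]|n1] := pselect (exists y1, y1 < q y /\ (psi y1 < +oo)%E); last first.
    apply: cstcase; apply: fq => //; apply: ae_OmegaS fino => m Om fo.
    have [Xm|Xm] := eqVneq (X m) y; last by rewrite level_ind_out// mulr0.
    rewrite valE// subr_ge0 leNgt; apply/negP => h; apply: n1.
    by exists (f m).
  have [[y2 [qy2 y2o]]|n2] := pselect (exists y2, q y < y2 /\ (psi y2 < +oo)%E); last first.
    apply: cstcase.
    have h : {ae mu, forall m, 0 <= (f - level_proj X s f) m * (- level_ind X y) m}.
      apply: ae_OmegaS fino => m Om fo.
      have -> : (- level_ind X y) m = - level_ind X y m by [].
      rewrite mulrN; have [Xm|Xm] := eqVneq (X m) y; last first.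
        by rewrite level_ind_out// mulr0 oppr0.
      rewrite valE// oppr_ge0 subr_le0 leNgt; apply/negP => h; apply: n2.
      by exists (f m).
    have us : uniq s by case: vX.
    have /(inner_ae_eq0 h) : inner (f - level_proj X s f) (- level_ind X y) = 0.
      by rewrite innerNr level_proj_orth_ind// oppr0.
    apply: ae_OmegaS => m Om + [_ Xm].
    have -> : (- level_ind X y) m = - level_ind X y m by [].
    by rewrite mulrN valE// => /eqP; rewrite oppr_eq0 subr_eq0 => /eqP.
  have [p Hp] := subgradient psi0 cpsi y1q qy2 y1o y2o.
  by exists p; apply: ae_Omega => m _ _; exact: Hp.
have /choice[p Hp] := tangent.
have Hp' : {ae mu, forall m, (psi (q (X m)) + (p (X m) * (f m - q (X m)))%:E <= psi (f m))%E}.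
  have : {ae mu, forall m, forall y, y \in s -> level X y m ->
      (psi (q y) + (p y * (f m - q y))%:E <= psi (f m))%E}.
    elim: s {vX fq tangent} => [|y r IH]; first by apply: ae_Omega.
    by apply: filterS2 (Hp y) IH => m h1 h2 z; rewrite inE => /predU1P[->|/h2].
  apply: ae_OmegaS => m Om H; apply: (H (X m)) => //.
  by case: (vX) => _; apply.
pose g : L2 R := \sum_(y <- s) p y *: level_ind X y.
pose k := f - level_proj X s f.
have kg0 : inner k g = 0.
  apply: (level_proj_orth f KX vX).
  by apply: H_of_sum => y; apply: H_ofZ; exact: H_of_level_ind.
pose h := EFin \o (fun m : T => k m * g m).
have ih : mu.-integrable setT h by exact: inner_integrable.
have h0 : (\int[mu]_m h m = 0)%E.
  rewrite -(fineK (integrable_fin_num measurableT ih)).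
  by congr EFin; exact: kg0.
have mh : measurable_fun setT h by case/integrableP: ih.
(* The linear term is split between the two sides so that only nonnegative functions are
   integrated. *)
have le_h : {ae mu, forall m, (psi (P m) + h^\+ m <= psi (f m) + h^\- m)%E}.
  apply: ae_OmegaS (ae_OmegaI Pq Hp') => m Om [-> H].
  have hm : h m = (p (X m) * (f m - q (X m)))%:E.
    rewrite /h /= /g level_sum_at// mulrC; congr (_ * _)%:E.
    by rewrite /q -(level_proj_at f vX Om).
  move: H; rewrite funeposE funenegE hm; move: (p _ * _) => r H.
  rewrite -EFinN -!EFin_max; have [r0|r0] := leP 0 r.
    by rewrite max_r ?oppr_le0// adde0.
  by rewrite max_l ?oppr_ge0 ?(ltW r0)// adde0 EFinN leeBrDr.
have fin_p : (\int[mu]_m h^\+ m \is a fin_num)%E by exact: integrable_pos_fin_num.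
have fin_n : (\int[mu]_m h^\- m \is a fin_num)%E by exact: integrable_neg_fin_num.
have pn : (\int[mu]_m h^\+ m = \int[mu]_m h^\- m)%E.
  by move: h0; rewrite integralE => /eqP; rewrite sube_eq ?add0e// => /eqP.
rewrite -(leeD2rE _ _ fin_p) [in leRHS]pn.
rewrite -!ge0_integralD//; last 2 first.
- exact: measurable_funeneg.
- exact: measurable_funepos.
apply: ae_ge0_le_integral => //.
- by move=> m _; rewrite adde_ge0.
- by apply: emeasurable_funD => //; exact: measurable_funepos.
- by move=> m _; rewrite adde_ge0.
- by apply: emeasurable_funD => //; exact: measurable_funeneg.
- by apply: filterS le_h => m ? _.
Qed.

End Jensen.

(** * The sticky evolution *)

Section StickyEvolution.
Variables (R : realType) (F : L2 R -> L2 R) (X V Z Vm : R -> L2 R).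
Variables (K : nat) (tk : nat -> R).

Implicit Types (t : R) (k : nat) (h U Y : L2 R).

(** For the last index the upper bound is void, so the final stage is a half-line although all [tk]
    are real. *)
Definition stage k : set R :=
  [set t | tk k <= t /\ ((k.+1 < K)%N -> t < tk k.+1)].

Hypothesis HF : force_unif_continuous F.
Hypothesis K_gt0 : (0 < K)%N.
Hypothesis tk0 : tk 0 = 0.
Hypothesis tk_lt : forall k, (k.+1 < K)%N -> tk k < tk k.+1.
Hypothesis KX : forall t, 0 <= t -> Kcone R (X t).
Hypothesis cX : L2_continuous X.
Hypothesis X0_values : exists s, has_values (X 0) s.
Hypothesis HX_stage : forall k t, (k < K)%N -> stage k t ->
  H_of (X t) = H_of (X (tk k)).
Hypothesis dX_stage : forall k t, (k < K)%N -> stage k t ->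
  deriv_within (stage k) X t (V t).
Hypothesis projZ : forall k t, (k < K)%N -> stage k t ->
  is_proj (H_of (X t)) (F (X t)) (Z t).
Hypothesis dV_stage : forall k t, (k < K)%N -> stage k t ->
  deriv_within (stage k) V t (Z t).
Hypothesis HX_coll : forall k t, (0 < k < K)%N -> 0 <= t < tk k ->
  H_of (X (tk k)) `<=` H_of (X t).
Hypothesis cvgVm : forall k, (0 < k < K)%N -> L2cvg V ((tk k)^'-) (Vm (tk k)).
Hypothesis projVm : forall k, (0 < k < K)%N ->
  is_proj (H_of (X (tk k))) (Vm (tk k)) (V (tk k)).

(** * Collision times, stages and the decrease of [H_of (X t)] *)

Lemma tk_mono j k : (j <= k)%N -> (k < K)%N -> tk j <= tk k.
Proof.
elim: k => [|k IH]; first by rewrite leqn0 => /eqP ->.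
rewrite leq_eqVlt => /predU1P[-> //|jk] kK.
by apply: le_trans (IH _ (ltnW kK)) _ => //; exact/ltW/tk_lt.
Qed.

Lemma tk_ge0 k : (k < K)%N -> 0 <= tk k.
Proof. by move=> kK; rewrite -tk0; exact: tk_mono. Qed.

(** Identifies the collisions that have occurred by time [t]: sums over them are constant on a
    stage, and stages are disjoint. *)
Lemma tk_le_stage k j t : (k < K)%N -> stage k t -> (j < K)%N ->
  (tk j <= t) = (j <= k)%N.
Proof.
move=> kK [kt tk1] jK; apply/idP/idP => [jt|jk].
  rewrite leqNgt; apply/negP => kj.
  have k1K : (k.+1 < K)%N := leq_ltn_trans kj jK.
  by have := tk1 k1K; rewrite ltNge (le_trans (tk_mono kj jK) jt).
by rewrite (le_trans (tk_mono jk kK) kt).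
Qed.

Lemma stage_exists t : 0 <= t -> exists2 k, (k < K)%N & stage k t.
Proof.
move=> t0.
(* The search runs downward from the last stage, where the upper bound holds vacuously. *)
suff H j : (j < K)%N -> ((j.+1 < K)%N -> t < tk j.+1) ->
    exists2 k, (k < K)%N & stage k t.
  apply: (H K.-1); first by rewrite prednK.
  by rewrite prednK// ltnn.
elim: j => [|j IH] jK jt; first by exists 0%N => //; split; rewrite ?tk0.
have [tj|tj] := leP (tk j.+1) t; first by exists j.+1.
by apply: IH => //; exact: ltnW.
Qed.

Lemma H_of_evolution_mono t1 t2 : 0 <= t1 -> t1 <= t2 ->
  H_of (X t2) `<=` H_of (X t1).
Proof.
move=> t10 t12; have [k kK kt2] := stage_exists (le_trans t10 t12).
have [kt1|t1k] := leP (tk k) t1.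
  have kt1' : stage k t1 by split=> // /kt2.2; exact: le_lt_trans.
  by rewrite (HX_stage kK kt2) (HX_stage kK kt1').
rewrite (HX_stage kK kt2); apply: HX_coll; last by rewrite t10.
rewrite kK andbT lt0n; apply: contraTneq t1k => ->.
by rewrite tk0 -leNgt.
Qed.

Lemma H_of_evolution t1 t2 : 0 <= t1 -> t1 <= t2 -> H_of (X t1) (X t2).
Proof. by move=> t10 t12; apply: (H_of_evolution_mono t10 t12); exact: H_of_self. Qed.

Lemma has_values_evolution t : 0 <= t -> exists s, has_values (X t) s.
Proof.
move=> t0; have [s vs] := X0_values.
by apply: (has_values_H_of (KX (lexx 0)) (KX t0) vs); exact: H_of_evolution.
Qed.

Definition tks : seq R := map tk (iota 0 K).

Lemma mem_tks k : (k < K)%N -> tk k \in tks.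
Proof. by move=> kK; apply: map_f; rewrite mem_iota. Qed.

Lemma stage_right k t : stage k t -> \forall s \near t, t <= s -> stage k s.
Proof.
move=> [kt tk1].
have [k1K|k1K] := boolP (k.+1 < K)%N; last first.
  apply/nbhs_ballP; exists 1 => [|s _ ts]; first exact: ltr01.
  split; first exact: le_trans ts.
  by move=> h; rewrite h in k1K.
have := lt_nbhsl (tk1 k1K).
by apply: filterS => s sk ts; split=> //; exact: le_trans ts.
Qed.

Lemma stage_left k t : tk k < t -> stage k t -> \forall s \near t, s <= t -> stage k s.
Proof.
move=> kt [_ tk1]; have := lt_nbhsr kt.
apply: filterS => s ks st; split; first exact: ltW.
by move=> /tk1; exact: le_lt_trans.
Qed.

Lemma stage_near k t : tk k < t -> stage k t -> \forall s \near t, stage k s.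
Proof.
move=> kt st; apply: filterS2 (stage_right st) (stage_left kt st) => s h1 h2.
by case: (leP t s) => [/h1|/ltW /h2].
Qed.

Lemma stage_interior t : 0 <= t -> t \notin tks ->
  exists2 k, (k < K)%N & stage k t /\ \forall s \near t, stage k s.
Proof.
move=> t0 tD; have [k kK st] := stage_exists t0.
exists k => //; split=> //; apply: stage_near (st).
rewrite lt_neqAle st.1 andbT; apply: contraNneq tD => <-.
exact: mem_tks.
Qed.

(** * Derivatives, continuity and local bounds along the evolution *)

Lemma time_deriv_X t : 0 <= t -> t \notin tks -> time_deriv X t (V t).
Proof.
move=> t0 tD; have [k kK [st nst]] := stage_interior t0 tD.
by apply: deriv_within_sub (dX_stage kK st); apply: filterS nst.
Qed.

Lemma time_deriv_V t : 0 <= t -> t \notin tks -> time_deriv V t (Z t).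
Proof.
move=> t0 tD; have [k kK [st nst]] := stage_interior t0 tD.
by apply: deriv_within_sub (dV_stage kK st); apply: filterS nst.
Qed.

Lemma right_deriv_X : is_velocity X V.
Proof.
move=> t t0; have [k kK st] := stage_exists t0.
apply: deriv_within_sub (dX_stage kK st).
by apply: filterS (stage_right st) => s H; rewrite /= in_itv /= andbT => /ltW.
Qed.

Lemma cvg_FX t : 0 <= t ->
  L2cvg (F \o X) (within `[0, +oo[%classic (nbhs t)) (F (X t)).
Proof.
move=> t0; have [_ [om [om0 om_gt0 om_cont _] Hom]] := HF.
apply/L2cvgP => e e0.
have /subspace_continuousP /(_ 0) := om_cont.
rewrite /= in_itv /= lexx => /(_ isT) /cvgrPdist_le /(_ e e0).
rewrite !near_withinE => /nbhs_ballP [d /= d0 Hd].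
have om_le r : 0 <= r -> r < d -> om r <= e.
  move=> r0 rd; have h : `|om 0 - om r| <= e.
    apply: Hd; last by rewrite in_itv /= r0.
    by rewrite /ball /= sub0r normrN ger0_norm.
  by move: h; rewrite om0 sub0r normrN; apply: le_trans; exact: ler_norm.
(* Halving [d] turns the weak inequality of [L2cvgP] into the strict one required by [om_le]. *)
have /L2cvgP /(_ (d / 2)) := cX t0.
rewrite divr_gt0// => /(_ isT); rewrite !near_withinE.
apply: filterS => s H s0.
have s0' : 0 <= s by move: s0; rewrite /= in_itv /= andbT.
apply: le_trans (Hom _ _ (KX s0') (KX t0)) _.
apply: om_le; first exact: L2norm_ge0.
by apply: le_lt_trans (H s0) _; rewrite ltr_pdivrMr// mulr2n mulrDr mulr1 ltrDl.
Qed.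

Lemma cvg_FX_nbhs t : 0 < t -> L2cvg (F \o X) (nbhs t) (F (X t)).
Proof.
move=> t0; apply/L2cvgP => e e0.
have /L2cvgP /(_ e e0) := cvg_FX (ltW t0); rewrite near_withinE => H.
apply: filterS2 H (lt_nbhsr t0) => s H s0; apply: H.
by rewrite /= in_itv /= andbT ltW.
Qed.

(** Inside a stage all projections are onto the same subspace and do not increase distances, so [Z]
    inherits the continuity of [F \o X]. *)
Lemma cvg_Z t : 0 <= t -> t \notin tks -> L2cvg Z (nbhs t) (Z t).
Proof.
move=> t0 tD; have [k kK [st nst]] := stage_interior t0 tD.
have t0' : 0 < t.
  rewrite lt_neqAle t0 andbT; apply: contraNneq tD => <-.
  by rewrite -tk0; exact: mem_tks.
apply/L2cvgP => e e0; have /L2cvgP /(_ e e0) := cvg_FX_nbhs t0'.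
apply: filterS2 nst => s ss; apply: le_trans.
have := projZ kK ss; rewrite (HX_stage kK ss) -(HX_stage kK st) => pZs.
exact: is_proj_dist (H_of_subspace _) pZs (projZ kK st).
Qed.

Lemma cvg_V_stage k t : (k < K)%N -> stage k t ->
  L2cvg V (within (stage k) (nbhs t)) (V t).
Proof. by move=> kK st; exact: deriv_within_cvg (dV_stage kK st). Qed.

Lemma bounded_FX T : 0 <= T -> exists2 M, 0 <= M &
  forall t, 0 <= t <= T -> L2norm (F (X t)) <= M.
Proof.
move=> T0; have [[C C0 HC] _] := HF.
have cN : {within `[0, T], continuous (fun t => L2norm (X t))}.
  apply/subspace_continuousP => t /=; rewrite in_itv /= => /andP[t0 tT].
  apply: L2cvg_norm; apply: L2cvg_within_sub (cX t0); apply: nearW => s /=.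
  by rewrite !in_itv /= => /andP[-> _].
have [c _ Hc] := EVT_max T0 cN.
exists (C * (1 + L2norm (X c))).
  by rewrite mulr_ge0// addr_ge0// L2norm_ge0.
move=> t tT; apply: le_trans (HC _ (KX _)) _; first by case/andP: tT.
by rewrite ler_wpM2l// lerD2l; apply: Hc; rewrite in_itv.
Qed.

Lemma bounded_Z T : 0 <= T -> exists2 M, 0 <= M &
  forall t, 0 <= t <= T -> L2norm (Z t) <= M.
Proof.
move=> T0; have [M M0 HM] := bounded_FX T0; exists M => // t tT.
have [k kK st] : exists2 k, (k < K)%N & stage k t by apply: stage_exists; case/andP: tT.
exact: le_trans (is_proj_norm (H_of_subspace _) (projZ kK st)) (HM t tT).
Qed.

Lemma bounded_V T : 0 <= T -> exists2 M, 0 <= M &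
  forall t, 0 <= t <= T -> L2norm (V t) <= M.
Proof.
move=> T0; have [M M0 HM] := bounded_Z T0.
(* One bound for the velocities at the start of all stages; within a stage the velocity changes at
   rate at most [M]. *)
pose N := \sum_(k < K) L2norm (V (tk k)).
have N0 : 0 <= N by apply: sumr_ge0 => k _; exact: L2norm_ge0.
exists (N + M * T); first by rewrite addr_ge0// mulr_ge0.
move=> t /andP[t0 tT]; have [k kK st] := stage_exists t0.
have kt : tk k <= t := st.1.
have stg s : tk k <= s <= t -> stage k s.
  by move=> /andP[ks s_t]; split=> // /st.2; exact: le_lt_trans.
have h1 : L2norm (V t - V (tk k)) <= M * (t - tk k).
  apply: (@piecewise_L2_MVT _ tks _ Z) => //.
    move=> h; apply/subspace_continuousP => s /=; rewrite in_itv /= => skt.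
    apply: L2cvg_inner; apply: L2cvg_within_sub (cvg_V_stage kK (stg s skt)).
    by apply: nearW => r; rewrite /= in_itv; exact: stg.
  move=> s /andP[ks s_t] sD.
  have s0 : 0 <= s by apply: le_trans (ltW ks); exact: tk_ge0.
  split; first exact: time_deriv_V.
  by apply: HM; rewrite s0 (le_trans (ltW s_t)).
have h2 : L2norm (V (tk k)) <= N.
  by rewrite /N (bigD1 (Ordinal kK))//= lerDl sumr_ge0// => i _; exact: L2norm_ge0.
have h3 := L2normD (V t - V (tk k)) (V (tk k)); rewrite subrK in h3.
have h4 : M * (t - tk k) <= M * T.
  by rewrite ler_wpM2l//; have := tk_ge0 kK; lra.
lra.
Qed.

Lemma lip_loc_X : lip_loc X.
Proof.
move=> T T0; have [M M0 HM] := bounded_V T0; exists M.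
suff H a b : 0 <= a -> a <= b -> b <= T -> L2norm (X b - X a) <= M * (b - a).
  move=> s t /andP[s0 sT] /andP[t0 tT]; have [st|ts] := leP s t.
    by rewrite L2distC distrC ger0_norm ?subr_ge0// H.
  by rewrite ger0_norm ?subr_ge0 ?H// ltW.
move=> a0 ab bT; apply: (@piecewise_L2_MVT _ tks _ V) => //.
  by move=> h; exact: L2_continuous_inner.
move=> t /andP[at_ tb] tD; have t0 : 0 <= t by rewrite (le_trans a0)// ltW.
split; first exact: time_deriv_X.
by apply: HM; rewrite t0 (le_trans (ltW tb)).
Qed.

(** * Velocity lost in collisions *)

Definition jump k : L2 R := Vm (tk k) - V (tk k).

Lemma jump_orth k U : (0 < k < K)%N -> H_of (X (tk k)) U -> inner (jump k) U = 0.
Proof. by move=> kK HU; exact: is_proj_orth (H_of_subspace _) (projVm kK) HU. Qed.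

Lemma jump_orth_X k t : (0 < k < K)%N -> tk k <= t -> inner (jump k) (X t) = 0.
Proof.
move=> kK kt; apply: jump_orth => //; apply: H_of_evolution => //.
by apply: tk_ge0; case/andP: kK.
Qed.

(* Just before the collision the particles of a cluster are ordered in the same way
   as [Y], and they meet at [tk k]; hence <V, Y - Q> is not positive at some earlier
   time arbitrarily close to [tk k], where Q is the cluster average of Y. *)
Lemma jump_le0 k Y : (0 < k < K)%N -> Kcone R Y -> inner (jump k) Y <= 0.
Proof.
move=> kK KY; have /andP[k0 kK'] := kK.
have tk0' := tk_ge0 kK'; have KXk := KX tk0'.
have [s vs] := has_values_evolution tk0'.
pose phi := Y - level_proj (X (tk k)) s Y.
have phi_orth U : H_of (X (tk k)) U -> inner U phi = 0.
  by move=> HU; rewrite innerC; exact: level_proj_orth.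
have -> : inner (jump k) Y = inner (Vm (tk k)) phi.
  have e1 : inner (jump k) (level_proj (X (tk k)) s Y) = 0.
    by apply: jump_orth => //; exact: H_of_level_proj.
  have e2 : inner (V (tk k)) phi = 0 by apply: phi_orth; case: (projVm kK).
  rewrite -[RHS]subr0 -e2 -innerBl -/(jump k) /phi innerBr e1; lra.
rewrite leNgt; apply/negP => pos.
have cVm : inner (V t) phi @[t --> (tk k)^'-] --> inner (Vm (tk k)) phi.
  by apply: L2cvg_inner; exact: cvgVm.
have : \forall t \near (tk k)^'-, 0 < inner (V t) phi by exact: (cvgr_gt _ cVm).
rewrite near_withinE => /nbhs_ballP [d /= d0 Hd].
have k1 : k.-1.+1 = k by rewrite prednK.
have k1K : (k.-1.+1 < K)%N by rewrite k1.
(* From [a] on, the curve is in the preceding stage, where it is differentiable, and within [d] of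
   the collision, where the pairing of [V] with [phi] is positive. *)
pose a : R := Num.max (tk k - d / 2) (tk k.-1).
have ak : a < tk k.
  rewrite /a gt_max ltrBlDr ltrDl divr_gt0//=.
  by have := tk_lt k1K; rewrite k1.
have a0 : 0 <= a.
  by rewrite /a le_max; apply/orP; right; apply: tk_ge0; rewrite (ltn_trans _ k1K).
have kda : tk k - d / 2 <= a by rewrite /a le_max lexx.
have dphi t : t \in `]a, tk k[ ->
    is_derive t 1 (fun s => inner (X s) phi) (inner (V t) phi).
  rewrite in_itv /= => /andP[at_ tk_]; apply: time_deriv_inner.
  have st : stage k.-1 t.
    split; last by rewrite k1.
    by apply: le_trans (ltW at_); rewrite /a le_max lexx orbT.
  have st' : tk k.-1 < t by apply: le_lt_trans at_; rewrite /a le_max lexx orbT.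
  have k1K' : (k.-1 < K)%N by rewrite (ltn_trans _ k1K).
  apply: deriv_within_sub (dX_stage k1K' st).
  by apply: filterS (stage_near st' st).
(* The pairing of [X] with [phi] would strictly increase to its value 0 at the collision, although
   Chebyshev's inequality makes it nonnegative at [a]. *)
have [xi xia] := MVT ak dphi (L2_continuous_inner a0 cX).
rewrite (phi_orth _ (@H_of_self R (X (tk k)))) sub0r => e.
have Vxi : 0 < inner (V xi) phi.
  move: xia; rewrite in_itv /= => /andP[axi xik]; apply: Hd => //.
  rewrite /ball /= ger0_norm ?subr_ge0 ?(ltW xik)//.
  have := divr_gt0 d0 (ltr0Sn R 1); lra.
have [sa va] := has_values_evolution a0.
have [B HB] := has_values_bounded va.
have : 0 <= inner (X a) phi by exact: (Chebyshev_level KXk vs (KX a0) KY HB).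
rewrite leNgt => /negP; apply.
by rewrite -oppr_gt0 e mulr_gt0// subr_gt0.
Qed.

(** Continuity can fail only from the left at a collision; there the drop of [V] is exactly the term
    that enters [S]. *)
Lemma momentum_cvg (alpha beta : R) h t (S : R -> R) :
  (forall s, S s = \sum_(1 <= j < K | tk j <= s)
     (alpha + beta * tk j) * inner (jump j) h) ->
  0 <= t ->
  (alpha + beta * s) * inner (V s) h + S s
    @[s --> within `[0, +oo[%classic (nbhs t)] -->
  (alpha + beta * t) * inner (V t) h + S t.
Proof.
move=> SE t0; pose c s := alpha + beta * s.
have cc (G : set_system R) : Filter G -> G --> t -> c s @[s --> G] --> c t.
  move=> FG Gt; apply: cvgD; first exact: cvg_cst.
  by apply: cvgM; [exact: cvg_cst|exact: Gt].
have S_stage k s : (k < K)%N -> stage k s -> S s =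
    \sum_(1 <= j < k.+1) (alpha + beta * tk j) * inner (jump j) h.
  move=> kK ks; rewrite SE [RHS](big_nat_widen _ _ K)//.
  rewrite [LHS]big_nat_cond [RHS]big_nat_cond; apply: eq_bigl => j.
  by have [/andP[_ jK]|//] := boolP (1 <= j < K)%N; rewrite /= (tk_le_stage kK ks jK) ltnS.
have [k kK st] := stage_exists t0.
apply/cvgrPdist_le => /= e e0.
have in_stage : \forall s \near t, stage k s ->
    `|c t * inner (V t) h + S t - (c s * inner (V s) h + S s)| <= e.
  have : c s * inner (V s) h @[s --> within (stage k) (nbhs t)] --> c t * inner (V t) h.
    apply: cvgM; last by apply: L2cvg_inner; exact: cvg_V_stage.
    by apply: cc; exact: cvg_within.
  move=> /cvgrPdist_le /(_ e e0); rewrite near_withinE; apply: filterS => s H ks.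
  by rewrite (S_stage k s kK ks) (S_stage k t kK st) opprD addrACA subrr addr0; exact: H.
have right_t : \forall s \near t, t <= s ->
    `|c t * inner (V t) h + S t - (c s * inner (V s) h + S s)| <= e.
  by apply: filterS2 in_stage (stage_right st) => s H1 H2 /H2.
suff left_t : \forall s \near t, 0 <= s -> s < t ->
    `|c t * inner (V t) h + S t - (c s * inner (V s) h + S s)| <= e.
  rewrite near_withinE; apply: filterS2 left_t right_t => s H1 H2.
  rewrite /= in_itv /= andbT => s0.
  by case: (leP t s) => [/H2|/(H1 s0)].
have [ktt|] := ltP (tk k) t.
  by apply: filterS2 in_stage (stage_left ktt st) => s H1 H2 _ /ltW /H2.
move=> tkt; have {tkt} tkt : t = tk k by apply/eqP; rewrite eq_le tkt st.1.
(* The start of stage 0 is time 0, with no admissible times to its left; the start of a later stage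
   is a collision. *)
case: k kK st in_stage tkt => [_ _ _ tt|k kK st _ tt].
  rewrite tt tk0; apply/nbhs_ballP; exists 1 => [|s _ s0]; first exact: ltr01.
  by rewrite ltNge s0.
have : c s * inner (V s) h @[s --> t^'-] --> c t * inner (Vm t) h.
  apply: cvgM; first by apply: cc; exact: cvg_within.
  by apply: L2cvg_inner; rewrite tt; apply: cvgVm; rewrite kK.
move=> /cvgrPdist_le /(_ e e0); rewrite near_withinE.
have kt : tk k < t by rewrite tt tk_lt.
apply: filterS2 (lt_nbhsr kt) => s ks H s0 s_t.
have sst : stage k s by split; [exact: ltW|rewrite -tt].
rewrite (S_stage _ _ kK st) (S_stage _ _ (ltnW kK) sst) big_nat_recr//= -tt.
have := H s_t; rewrite /jump -tt innerBl -/(c t).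
set A := \sum_(_ <= _ < _) _; set B := inner (Vm t) h; set C := inner (V t) h.
have -> // : c t * C + (A + c t * (B - C)) - (c s * inner (V s) h + A) =
   c t * B - c s * inner (V s) h by ring.
Qed.

(* The jumps of V are compensated by the sum, so that the sum of the two is an
   antiderivative. *)
Lemma momentum (alpha beta : R) h t1 t2 : 0 <= t1 -> t1 <= t2 ->
  \int[@lebesgue_measure R]_(s in `[t1, t2])
    ((alpha + beta * s) * inner (Z s) h) =
  (alpha + beta * t2) * inner (V t2) h - (alpha + beta * t1) * inner (V t1) h
  - beta * (inner (X t2) h - inner (X t1) h)
  + \sum_(1 <= k < K | t1 < tk k <= t2) (alpha + beta * tk k) * inner (jump k) h.
Proof.
move=> t10 t12; pose c s := alpha + beta * s.
pose S s := \sum_(1 <= j < K | tk j <= s) c (tk j) * inner (jump j) h.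
(* The product rule produces [beta * inner (V s) h], which the last term cancels. *)
pose g s := c s * inner (V s) h + S s - beta * inner (X s) h.
have -> : \sum_(1 <= k < K | t1 < tk k <= t2) (alpha + beta * tk k) * inner (jump k) h
    = S t2 - S t1.
  rewrite /S [X in X - _](bigID (fun k => tk k <= t1))/=.
  rewrite [X in _ = X + _ - _](eq_bigl (fun k => tk k <= t1)); last first.
    move=> k /=; apply: andb_idl => kt1; exact: le_trans kt1 t12.
  rewrite [RHS]addrAC subrr add0r; apply: eq_bigl => k.
  by rewrite -ltNge andbC.
transitivity (g t2 - g t1); last by rewrite /g -/(c t1) -/(c t2); ring.
have [M M0 HM] := bounded_Z (le_trans t10 t12).
apply: (@piecewise_FTC _ tks _ _ _ _ ((`|alpha| + `|beta| * t2) * (M * L2norm h))) => //.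
- apply/subspace_continuousP => t /=; rewrite in_itv /= => /andP[t1t tt2].
  have t0 := le_trans t10 t1t.
  have sub : within `[t1, t2]%classic (nbhs t) `=>` within `[0, +oo[%classic (nbhs t).
    apply: within_subset => s /=; rewrite !in_itv /= => /andP[t1s _].
    by rewrite (le_trans t10).
  have cP := @momentum_cvg alpha beta h t S (fun=> erefl) t0.
  apply: cvgB; first exact: cvg_trans (cvg_app _ sub) cP.
  apply: cvgM; first exact: cvg_cst.
  by apply: cvg_trans (cvg_app _ sub) _; apply: L2cvg_inner; exact: cX.
- move=> t /andP[t1t tt2] tD; have t0 : 0 <= t by apply: le_trans t10 (ltW t1t).
  have cc : {for t, continuous c}.
    by apply: cvgD; [exact: cvg_cst|apply: cvgM; [exact: cvg_cst|exact: cvg_id]].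
  split; last first.
    by apply: cvgM; [exact: cc|apply: L2cvg_inner; exact: cvg_Z].
  have [k kK [st nst]] := stage_interior t0 tD.
  have Sst : \forall s \near t, S s = S t.
    apply: filterS nst => s ss; rewrite /S [LHS]big_nat_cond [RHS]big_nat_cond.
    apply: eq_bigl => j; have [/andP[_ jK]|//] := boolP (1 <= j < K)%N.
    by rewrite (tk_le_stage kK ss jK) (tk_le_stage kK st jK).
  have dc : is_derive t 1 c beta.
    have := is_deriveD (is_derive_cst alpha t 1) (is_deriveZ beta (is_derive_id t 1)).
    by rewrite add0r [_ *: 1]mulr1.
  have dV := time_deriv_inner h (time_deriv_V t0 tD).
  have dX := time_deriv_inner h (time_deriv_X t0 tD).
  have d1 := is_deriveB (is_deriveD (is_deriveM dc dV) (is_derive_cst (S t) t 1))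
    (is_deriveZ beta dX).
  have -> : c t * inner (Z t) h = c t *: inner (Z t) h + inner (V t) h *: beta + 0 -
      beta *: inner (V t) h.
    by rewrite addr0 /GRing.scale /= (mulrC beta) addrK.
  by apply: near_eq_is_derive d1; apply: filterS Sst => s Ss; rewrite /g Ss.
- move=> t /andP[t1t tt2]; have t0 := le_trans t10 t1t.
  rewrite normrM; apply: ler_pM => //.
    apply: (le_trans (ler_normD _ _)); rewrite lerD2l normrM ler_wpM2l//.
    by rewrite ger0_norm.
  apply: (le_trans (normr_inner_le _ _)); apply: ler_wpM2r; first exact: L2norm_ge0.
  by apply: HM; rewrite t0.
Qed.

(** The affine weight serves two purposes: [1, 0] gives the integral of [Z], and [t2, -1] gives the
    weight [t2 - s] of the projection formula. *)
Lemma evolution_bochner (alpha beta : R) t1 t2 : 0 <= t1 -> t1 <= t2 ->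
  exists2 I, bochner_integral t1 t2 (fun s => (alpha + beta * s) *: Z s) I &
    forall h, inner I h =
      (alpha + beta * t2) * inner (V t2) h - (alpha + beta * t1) * inner (V t1) h
      - beta * (inner (X t2) h - inner (X t1) h)
      + \sum_(1 <= k < K | t1 < tk k <= t2) (alpha + beta * tk k) * inner (jump k) h.
Proof.
move=> t10 t12; have [M M0 HM] := bounded_Z (le_trans t10 t12).
have [||I bI HI] := @piecewise_bochner R tks t1 t2
  (fun s => (alpha + beta * s) *: Z s) ((`|alpha| + `|beta| * t2) * M) t12.
- move=> t /andP[t1t tt2] tD; have t0 : 0 <= t by apply: le_trans t10 (ltW t1t).
  apply: L2cvgZ; last exact: cvg_Z.
  by apply: cvgD; [exact: cvg_cst|apply: cvgM; [exact: cvg_cst|exact: cvg_id]].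
- move=> t /andP[t1t tt2]; have t0 := le_trans t10 t1t.
  rewrite L2normZ; apply: ler_pM => //; first exact: L2norm_ge0.
    apply: (le_trans (ler_normD _ _)); rewrite lerD2l normrM ler_wpM2l//.
    by rewrite ger0_norm.
  by apply: HM; rewrite t0.
exists I => // h; rewrite HI -momentum//.
by apply: eq_Rintegral => s _; rewrite innerZl.
Qed.

Lemma evolution_bochner_Z t1 t2 : 0 <= t1 -> t1 <= t2 ->
  exists2 I, bochner_integral t1 t2 Z I &
    forall h, inner I h = \int[@lebesgue_measure R]_(s in `[t1, t2]) inner (Z s) h /\
      inner (V t1 + I - V t2) h =
      \sum_(1 <= k < K | t1 < tk k <= t2) inner (jump k) h.
Proof.
move=> t10 t12; have [I bI HI] := evolution_bochner 1 0 t10 t12.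
exists I.
  have -> : Z = (fun s => (1 + 0 * s) *: Z s).
    by apply/funext => s; rewrite mul0r addr0 scale1r.
  exact: bI.
move=> h; split.
  have := momentum 1 0 h t10 t12; rewrite -HI => <-.
  by apply: eq_Rintegral => s _; rewrite mul0r addr0 mul1r.
rewrite innerBl innerDl HI !mul0r !addr0 !mul1r subr0.
rewrite (eq_bigr (fun k => inner (jump k) h)); first by ring.
by move=> k _; rewrite mul0r addr0 mul1r.
Qed.

Lemma inner_jump_le0 k t Y : (0 < k < K)%N -> tk k <= t -> Kcone R Y ->
  inner (jump k) (Y - X t) <= 0.
Proof. by move=> kK kt KY; rewrite innerBr jump_orth_X// subr0 jump_le0. Qed.

Lemma evolution_subdiff t1 t2 I : 0 <= t1 -> t1 <= t2 ->
  (forall h, inner (V t1 + I - V t2) h =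
     \sum_(1 <= k < K | t1 < tk k <= t2) inner (jump k) h) ->
  subdiffK (X t2) (V t1 + I - V t2).
Proof.
move=> t10 t12 HI Y KY; rewrite HI big_nat_cond; apply: sumr_le0 => k.
by move=> /andP[kK /andP[_ kt]]; exact: inner_jump_le0.
Qed.

Lemma evolution_proj t1 t2 : 0 <= t1 -> t1 <= t2 ->
  exists2 I, bochner_integral t1 t2 (fun s => (t2 - s) *: Z s) I &
    is_proj (Kcone R) (X t1 + (t2 - t1) *: V t1 + I) (X t2).
Proof.
move=> t10 t12; have [I bI HI] := evolution_bochner t2 (-1) t10 t12.
(* The weight [t2 - s] vanishes at [t2], so [V t2] drops out and the residual of the projection is a
   sum of jumps with coefficients [t2 - tk k]. *)
exists I.
  have -> : (fun s => (t2 - s) *: Z s) = (fun s => (t2 + -1 * s) *: Z s).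
    by apply/funext => s; rewrite mulN1r.
  exact: bI.
apply: is_proj_of_inner; first by apply: KX; exact: le_trans t12.
move=> Y KY; rewrite innerBl 2!innerDl innerZl HI !mulN1r subrr mul0r.
set S := \sum_(_ <= _ < _ | _) _.
suff : S <= 0 by lra.
rewrite /S big_nat_cond; apply: sumr_le0 => k /andP[kK /andP[_ kt]].
by apply: mulr_ge0_le0; [rewrite mulN1r subr_ge0|exact: inner_jump_le0].
Qed.

Lemma ae_tks (P : R -> Prop) : (forall t, 0 < t -> t \notin tks -> P t) ->
  {ae @lebesgue_measure R, forall t, 0 < t -> P t}.
Proof. by move=> H; apply: ae_lebS (ae_notin_seq tks) => t tD t0; exact: H. Qed.

Lemma Linfty_loc_Z : Linfty_loc Z.
Proof.
move=> T T0; have [M M0 HM] := bounded_Z (ltW T0).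
have [I [S [SZ _ _]] _] := evolution_bochner_Z (lexx 0) (ltW T0).
split; first by exists S.
exists M; apply: ae_lebS (ae_notin_seq [::]) => t _.
by rewrite /= in_itv; exact: HM.
Qed.

(** * The two notions of solution, with the merging at time 0 treated like a collision *)

Section InitialData.
Variables Xbar Vbar : L2 R.
Hypothesis X0bar : L2eq (X 0) Xbar.
Hypothesis Vbar_orth : forall t, 0 <= t -> inner (Vbar - V 0) (X t) = 0.
Hypothesis Vbar_le0 : forall Y, Kcone R Y -> inner (Vbar - V 0) Y <= 0.

Lemma curve_from_X : curve_from Xbar X.
Proof. by split=> //; exact: lip_loc_X. Qed.

Lemma inner_Vbar t Y I : 0 <= t -> Kcone R Y ->
  (forall h, inner (V 0 + I - V t) h =
     \sum_(1 <= k < K | 0 < tk k <= t) inner (jump k) h) ->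
  inner (Vbar + I - V t) (Y - X t) <= 0.
Proof.
move=> t0 KY HI; have := evolution_subdiff (lexx 0) t0 HI KY.
have : inner (Vbar - V 0) (Y - X t) <= 0 by rewrite innerBr Vbar_orth// subr0 Vbar_le0.
by rewrite !innerBl !innerDl; lra.
Qed.

Lemma generalized_evolution : generalized_lagrangian_pair F Xbar Vbar X V.
Proof.
split; [exact: curve_from_X|exact: right_deriv_X|exists Z; split].
- exact: Linfty_loc_Z.
- apply: ae_tks => t t0 _; have [k kK st] := stage_exists (ltW t0).
  have pZ := projZ kK st; have [s vs] := has_values_evolution (ltW t0).
  split; last exact: is_proj_convex_dominated (KX (ltW t0)) vs pZ.
  move=> U HU; have := is_proj_orth (H_of_subspace _) pZ HU.
  by rewrite !innerBl; lra.
- apply: ae_tks => t t0 tD; have [I bI HI] := evolution_bochner_Z (lexx 0) (ltW t0).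
  exists (V t), I; split=> //; first by apply: time_deriv_X => //; exact: ltW.
  by move=> Y KY; apply: inner_Vbar => //; [exact: ltW|move=> h; exact: (HI h).2].
- move=> t1 t t10 t1t; have [I bI HI] := evolution_bochner_Z t10 t1t.
  by exists I => //; apply: evolution_subdiff => // h; exact: (HI h).2.
- exact: evolution_proj.
Qed.

Lemma sticky_evolution : force_sticking F -> sticky_lagrangian_pair F Xbar Vbar X V.
Proof.
move=> Fsticking; split; last exact: right_deriv_X.
  split; first exact: curve_from_X.
  apply: ae_tks => t t0 tD; have [I bI HI] := evolution_bochner_Z (lexx 0) (ltW t0).
  have [M M0 HM] := bounded_FX (ltW t0).
  have cFX s : 0 < s < t -> s \notin tks -> L2cvg (F \o X) (nbhs s) ((F \o X) s).
    by move=> /andP[s0 _] _; exact: cvg_FX_nbhs.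
  have [J bJ HJ] := piecewise_bochner (ltW t0) cFX HM.
  exists (V t), J; split=> //; first by apply: time_deriv_X => //; exact: ltW.
  move=> Y KY.
  have h1 : inner (Vbar + I - V t) (Y - X t) <= 0.
    by apply: inner_Vbar => //; [exact: ltW|move=> h; exact: (HI h).2].
  (* [J] integrates the force and [I] its projection. The comparison is pointwise in [s]: sticking
     applies to [X s] and [X t], since [X t] belongs to [H_of (X s)] for [s <= t]. *)
  suff h2 : inner J (Y - X t) <= inner I (Y - X t).
    by move: h1; rewrite !innerBl !innerDl; lra.
  rewrite HJ (HI _).1.
  have [N N0 HN] := bounded_Z (ltW t0).
  apply: le_Rintegral => //.
  - apply: (@piecewise_integrable _ tks _ _ _ (M * L2norm (Y - X t))).
      by move=> s s0t sD; apply: L2cvg_inner; exact: cFX.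
    move=> s s0t; apply: (le_trans (normr_inner_le _ _)).
    by apply: ler_wpM2r; [exact: L2norm_ge0|exact: HM].
  - apply: (@piecewise_integrable _ tks _ _ _ (N * L2norm (Y - X t))).
      move=> s /andP[s0 _] sD; apply: L2cvg_inner; apply: cvg_Z => //; exact: ltW.
    move=> s s0t; apply: (le_trans (normr_inner_le _ _)).
    by apply: ler_wpM2r; [exact: L2norm_ge0|exact: HN].
  - move=> s /=; rewrite in_itv /= => /andP[s0 st].
    have [k kK ss] := stage_exists s0.
    have := Fsticking (X s) (X t) (Z s) (KX s0) (KX (ltW t0))
      (H_of_evolution s0 st) (projZ kK ss) Y KY.
    by rewrite innerBl subr_le0.
move=> t1 t2 t10 t12; apply: Omega_of_mono; last exact: H_of_evolution.
by apply: KX; exact: le_trans t12.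
Qed.

End InitialData.

End StickyEvolution.

(* Every value of [step_fun m x] is a sum of some of the [x i], whether or not the
   intervals are disjoint. *)
Lemma step_fun_values (R : realType) (N : nat) (m x : 'I_N -> R) (X : L2 R) :
  Kcone R X -> L2eq X (step_fun m x) -> exists s, has_values X s.
Proof.
move=> KX /L2eq_ae Xm.
pose s := [seq \sum_(i < N) x i * (b i)%:R |
  b : {ffun 'I_N -> bool} <- enum {: {ffun 'I_N -> bool}}].
exists (undup s); split; first exact: undup_uniq.
apply: Kcone_ae_mem_Omega => //; apply: filterS Xm => y ->.
rewrite mem_undup; apply/mapP.
exists [ffun i => y \in `[mass_before m i, mass_before m i + m i[%classic].
  by rewrite mem_enum.
rewrite L2_sumE; apply: eq_bigr => i _.
by rewrite ffunE -indicE.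
Qed.

(* [V 0] is the velocity P_{H_Xbar}(Vbar) after merging particles that start at
   the same point. It equals [Vbar] (almost everywhere) unless some x i = x j with
   v i <> v j. In that degenerate case the initial datum [Vbar] requires that
   coincident particles are not moving apart, i.e. Vbar - V 0 belongs to
   subdiffK Xbar (a necessary condition: take N = 2, m = 1/2, x = 0, F = 0,
   v = (-1, 1)); the initial datum [V 0] is always admissible. *)
Theorem theorem5p2 (R : realType) (F : L2 R -> L2 R) (N : nat)
    (m x v : 'I_N -> R) (Xbar Vbar : L2 R) (X V : R -> L2 R) :
  force_unif_continuous F ->
  (forall i, 0 < m i) ->
  \sum_(i < N) m i = 1 ->
  (forall i j : 'I_N, (i <= j)%N -> x i <= x j) ->
  Xbar = step_fun m x ->
  Vbar = step_fun m v ->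
  discrete_sticky_evolution F Xbar Vbar X V ->
  [/\ subdiffK Xbar (Vbar - V 0) ->
        generalized_lagrangian_pair F Xbar Vbar X V /\
        (force_sticking F -> sticky_lagrangian_pair F Xbar Vbar X V),
      generalized_lagrangian_pair F Xbar (V 0) X V &
      force_sticking F -> sticky_lagrangian_pair F Xbar (V 0) X V].
Proof.
move=> HF _ _ _ XbarE _ [KX cX X0bar projV0 [K [tc [tc0 tcK tc_lt stg coll]]]].
have K_gt0 : (0 < K)%N by rewrite lt0n; apply/eqP => K0; move: tcK; rewrite K0 tc0.
(* [fine] sends the infinite time [tc K] to 0, so [tk] represents [tc] only at indices below [K]. *)
pose tk k := fine (tc k).
have tcE k : (k < K)%N -> tc k = (tk k)%:E.
  move=> kK; rewrite fineK// ge0_fin_numE; last first.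
    elim: k kK => [|k IH] kK; first by rewrite tc0.
    by apply: le_trans (IH (ltnW kK)) _; exact/ltW/tc_lt/ltnW.
  by apply: lt_le_trans (tc_lt k kK) _; rewrite leey.
have tk0 : tk 0%N = 0 by rewrite /tk tc0.
have tk_lt k : (k.+1 < K)%N -> tk k < tk k.+1.
  by move=> kK; rewrite -lte_fin -!tcE//; [exact/tc_lt/ltnW|exact: ltnW].
have stageE k : (k < K)%N ->
    [set t : R | (tc k <= t%:E)%E /\ (t%:E < tc k.+1)%E] = stage K tk k.
  move=> kK; apply/seteqP; split=> t /=.
    rewrite (tcE k kK) lee_fin => -[h1 h2]; split=> // k1.
    by move: h2; rewrite (tcE _ k1) lte_fin.
  rewrite (tcE k kK) => -[h1 h2]; rewrite lee_fin; split=> //.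
  have [k1|k1] := boolP (k.+1 < K)%N; first by rewrite (tcE _ k1) lte_fin h2.
  have -> : k.+1 = K by apply/eqP; rewrite eqn_leq kK leqNgt.
  by rewrite tcK ltry.
have stageP k t : (k < K)%N -> stage K tk k t ->
    [/\ H_of (X t) = H_of (X (tk k)), deriv_within (stage K tk k) X t (V t) &
      exists2 P, is_proj (H_of (X t)) (F (X t)) P & deriv_within (stage K tk k) V t P].
  move=> kK; rewrite -stageE// => kt.
  by have [/(_ t kt) [? _ ? ?] _] := stg k (tk k) kK (tcE k kK).
(* A time lies in at most one stage, so the projection given there can be chosen as a function of
   time alone; times in no stage get 0. *)
have /choice[Z HZ] : forall t, exists P, forall k, (k < K)%N -> stage K tk k t ->
    is_proj (H_of (X t)) (F (X t)) P /\ deriv_within (stage K tk k) V t P.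
  move=> t; have [[k [kK kt]]|nk] := pselect (exists k, (k < K)%N /\ stage K tk k t).
    have [_ _ [P h1 h2]] := stageP k t kK kt; exists P => j jK jt.
    suff -> : j = k by [].
    apply/eqP; rewrite eqn_leq -(tk_le_stage tk_lt kK kt jK) jt.1/=.
    by rewrite -(tk_le_stage tk_lt jK jt kK) kt.1.
  by exists 0 => k kK kt; exfalso; apply: nk; exists k.
have /choice[Vm HVm] : forall t, exists P, (exists2 k, (0 < k < K)%N & tk k = t) ->
    L2cvg V (t^'-) P /\ is_proj (H_of (X t)) P (V t).
  move=> t; have [[k kK kt]|nk] := pselect (exists2 k, (0 < k < K)%N & tk k = t).
    have tkE : tc k = t%:E by rewrite tcE ?kt//; case/andP: kK.
    by have [_ [P h1 h2]] := coll k t kK tkE; exists P.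
  by exists 0.
have HX_coll k t : (0 < k < K)%N -> 0 <= t < tk k -> H_of (X (tk k)) `<=` H_of (X t).
  move=> kK tk_; have kK' : (k < K)%N by case/andP: kK.
  by have [/(_ t tk_) []] := coll k _ kK (tcE k kK').
have vX0 : exists s, has_values (X 0) s.
  by apply: (@step_fun_values R N m x _ (KX 0 (lexx 0))); rewrite -XbarE.
have HX k t kK kt := let: And3 h _ _ := stageP k t kK kt in h.
have dX k t kK kt := let: And3 _ h _ := stageP k t kK kt in h.
have pZ k t kK kt := (HZ t k kK kt).1.
have dV k t kK kt := (HZ t k kK kt).2.
have cVm k (kK : (0 < k < K)%N) := (HVm (tk k) (ex_intro2 _ _ k kK erefl)).1.
have pVm k (kK : (0 < k < K)%N) := (HVm (tk k) (ex_intro2 _ _ k kK erefl)).2.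
have gen Vb := @generalized_evolution R F X V Z Vm K tk HF K_gt0 tk0 tk_lt KX cX vX0
  HX dX pZ dV HX_coll cVm pVm Xbar Vb X0bar.
have sti Vb := @sticky_evolution R F X V Z Vm K tk HF K_gt0 tk0 tk_lt KX cX vX0
  HX dX pZ dV HX_coll cVm pVm Xbar Vb X0bar.
have orth0 t : 0 <= t -> inner (V 0 - V 0) (X t) = 0 by rewrite subrr inner0l.
have le00 Y : Kcone R Y -> inner (V 0 - V 0) Y <= 0 by rewrite subrr inner0l.
split; [move=> subV|exact: gen|exact: sti].
(* Since [X 0] and [Xbar] agree almost everywhere, all later [X t] stay in [H_of Xbar], to which
   [Vbar - V 0] is orthogonal. *)
have X0H : H_of Xbar (X 0).
  apply: H_of_ae (@H_of_self R Xbar).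
  by apply: filterS (L2eq_ae X0bar) => y ->.
have orth t : 0 <= t -> inner (Vbar - V 0) (X t) = 0.
  move=> t0; apply: (is_proj_orth (H_of_subspace _) projV0).
  apply: (H_of_mono (KX 0 (lexx 0)) X0H).
  exact: (H_of_evolution K_gt0 tk0 HX HX_coll (lexx 0) t0).
have le0 Y : Kcone R Y -> inner (Vbar - V 0) Y <= 0.
  (* The competitor [Y + X 0] lies in the cone, and subtracting [Xbar] leaves [Y] up to a term of
     norm zero. *)
  move=> KY; have := subV _ (KconeD KY (KX 0 (lexx 0))).
  by rewrite -addrA innerDr (innerC _ (X 0 - Xbar)) (inner_eq0l _ X0bar) addr0.
by split; [exact: gen|exact: sti].
Qed.
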